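(* Let $d\ge1$, let $f\in L^1(\mathbb{R}^d)$, $f\ge0$, be an almost radial decreasing density, and let $\theta\in\mathbb{S}^{d-1}$ and $\gamma\ge0$ be such that $$\lim_{t\to\infty}\frac{f(t\theta-y)}{f(t\theta)} = e^{\gamma(\theta\cdot y)}\quad\text{for every } y\in\mathbb{R}^d .$$ For $\lambda>0$ let $$p_\lambda(x)=e^{-\lambda\|f\|_1}\sum_{n=1}^\infty\frac{\lambda^n}{n!}f^{n\star}(x),\quad x\in\mathbb{R}^d.$$ Then the following statements are equivalent. (a) $f\in\mathscr{S}_d(\theta,\gamma)$. (b) $\displaystyle\int_{\mathbb{R}^d}e^{\gamma(\theta\cdot y)}f(y)\,dy<\infty$ and, for every $\lambda>0$, $$\lim_{t\to\infty}\frac{p_\lambda(t\theta-y)}{\lambda f(t\theta)}=\exp\left(\gamma(\theta\cdot y)+\lambda\int_{\mathbb{R}^d}\left(e^{\gamma(\theta\cdot z)}-1\right)f(z)\,dz\right),\quad y\in\mathbb{R}^d.$$ (c) For some $\lambda>0$, $p_\lambda\in\mathscr{S}_d(\theta,\gamma)$ and $\displaystyle\limsup_{|x|\to\infty}\frac{p_\lambda(x)}{f(x)}<\infty$. (c') For every $\lambda>0$, $p_\lambda\in\mathscr{S}_d(\theta,\gamma)$ and $\displaystyle\limsup_{|x|\to\infty}\frac{p_\lambda(x)}{f(x)}<\infty$.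
   Context: A density is a non-negative, non-zero function $f\in L^1(\mathbb{R}^d)$ (with respect to Lebesgue measure; $f$ is a function defined pointwise). $\mathbb{S}^{d-1}$ is the unit sphere of $\mathbb{R}^d$. A function $g$ on $(0,\infty)$ is decreasing if $g(s)\ge g(t)$ whenever $s\le t$ (no strictness required). A density $f$ is almost radial decreasing if there are a decreasing function $g:(0,\infty)\to(0,\infty)$ and a constant $c\ge1$ with $c^{-1}g(|x|)\le f(x)\le c\,g(|x|)$ for all $x\in\mathbb{R}^d\setminus\{0\}$. $f^{n\star}$ is the $n$-fold convolution: $f^{1\star}=f$ and $f^{(n+1)\star}(x)=\int_{\mathbb{R}^d} f^{n\star}(x-y)f(y)\,dy$, defined pointwise with values in $[0,\infty]$. The function $p_\lambda$ (also understood pointwise, with values in $[0,\infty]$) is the density of the absolutely continuous part of the compound Poisson measure $P_\lambda(dx)=e^{-\lambda\|f\|_1}\delta_0(dx)+p_\lambda(x)\,dx$. Definition of $\mathscr{S}_d(\theta,\gamma)$: let $q\in L^1(\mathbb{R}^d)$, $q\ge0$, with $q(t\theta)>0$ for all $t\ge t_0$, for some $t_0>0$. Then $q\in\mathscr{S}_d(\theta,\gamma)$ if (i) $\lim_{t\to\infty} q(t\theta-y)/q(t\theta)=e^{\gamma(\theta\cdot y)}$ for every $y\in\mathbb{R}^d$, and (ii) $h(\theta):=\int_{\mathbb{R}^d}e^{\gamma(\theta\cdot y)}q(y)\,dy<\infty$ and $\lim_{t\to\infty}q^{2\star}(t\theta)/q(t\theta)=2h(\theta)$. *)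

(* Defs.v *)
From HB Require Import structures.
From mathcomp Require Import all_boot all_order all_algebra.
From mathcomp Require Import all_classical all_reals all_analysis.

Set Implicit Arguments.
Unset Strict Implicit.
Unset Printing Implicit Defensive.

Import Order.TTheory GRing.Theory Num.Theory.
Import numFieldNormedType.Exports.

Local Open Scope classical_set_scope.
Local Open Scope ring_scope.

(* The Borel sigma-algebra of R^n, generated by the coordinate maps. *)
Section borel_rV.
Context {R : realType} (n : nat).

Let coord (i : 'I_n) (x : 'rV[R]_n) : measurableTypeR R := x ord0 i.

Let rV_set0 : g_sigma_preimage coord set0.
Proof. exact: sigma_algebra0. Qed.

Let rV_setC A : g_sigma_preimage coord A -> g_sigma_preimage coord (~` A).
Proof. exact: sigma_algebraC. Qed.

Let rV_bigcup (F : _^nat) : (forall i, g_sigma_preimage coord (F i)) ->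
  g_sigma_preimage coord (\bigcup_i (F i)).
Proof. exact: sigma_algebra_bigcup. Qed.

HB.instance Definition _ := @isMeasurable.Build default_measure_display
  'rV[R]_n (g_sigma_preimage coord) rV_set0 rV_setC rV_bigcup.

Lemma measurable_coord (i : 'I_n) :
  measurable_fun [set: 'rV[R]_n] (fun x => x ord0 i : measurableTypeR R).
Proof.
move=> _ Y mY; rewrite setTI; apply: sub_sigma_algebra => /=.
rewrite -bigcup_seq/=; exists i => /=; first by rewrite mem_index_enum.
by exists Y => //; rewrite setTI.
Qed.

Lemma measurable_fun_rVP d (T : measurableType d) (f : T -> 'rV[R]_n) :
  measurable_fun setT f <->
  forall i, measurable_fun setT (fun t => f t ord0 i : measurableTypeR R).
Proof.
split=> [mf i|mf].
  by apply: (measurableT_comp (measurable_coord i) mf).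
move=> _ A mA; rewrite setTI.
have : image_set_system setT f measurable A.
  apply: (smallest_sub _ _ mA).
    exact/sigma_algebra_image/sigma_algebra_measurable.
  move=> B; rewrite -bigcup_seq/= => -[i _ [C mC <-]].
  rewrite /image_set_system /= !setTI.
  by have := mf i measurableT C mC; rewrite setTI.
by rewrite /image_set_system /= setTI.
Qed.

End borel_rV.

Section lebesgue_rV.
Context {R : realType}.

Definition cons_rV n (p : measurableTypeR R * 'rV[R]_n) : 'rV[R]_n.+1 :=
  row_mx (const_mx p.1 : 'rV[R]_1) p.2.


Lemma measurable_cons_rV n : measurable_fun setT (@cons_rV n).
Proof.
apply/measurable_fun_rVP => i.
have [j ->|j ->] := split_ordP (i : 'I_(1 + n)).
  rewrite (_ : (fun _ => _) = fst); first exact: measurable_fst.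
  by apply/funext => p; apply: (etrans (row_mxEl _ _ _ _)); rewrite mxE.
rewrite (_ : (fun _ => _) =
    (fun x : 'rV[R]_n => x ord0 j : measurableTypeR R) \o snd).
  exact: (measurableT_comp (measurable_coord j) measurable_snd).
by apply/funext => p; exact: row_mxEr.
Qed.

Section lebesgue_cons.
Local Open Scope ereal_scope.
Context n (m : {sigma_finite_measure set 'rV[R]_n -> \bar R}).

Definition lebesgue_cons : set 'rV[R]_n.+1 -> \bar R :=
  pushforward (@lebesgue_measure R \x m) (@cons_rV n).

Let pre A : measurable A -> measurable (@cons_rV n @^-1` A).
Proof.
by move=> mA; rewrite -[X in measurable X]setTI; exact: measurable_cons_rV.
Qed.

Let lebesgue_cons0 : lebesgue_cons set0 = 0.
Proof. by rewrite /lebesgue_cons /pushforward preimage_set0 measure0. Qed.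

Let lebesgue_cons_ge0 A : 0 <= lebesgue_cons A.
Proof. by rewrite /lebesgue_cons /pushforward measure_ge0. Qed.

Let lebesgue_cons_sigma_additive : semi_sigma_additive lebesgue_cons.
Proof.
move=> F mF tF mUF; rewrite /lebesgue_cons /pushforward preimage_bigcup.
apply: measure_semi_sigma_additive.
- by move=> k; exact: pre.
- apply/trivIsetP => /= i j _ _ ij; rewrite -preimage_setI.
  by move/trivIsetP : tF => /(_ _ _ _ _ ij) ->//; rewrite preimage_set0.
- by rewrite -preimage_bigcup; exact: pre.
Qed.

HB.instance Definition _ := isMeasure.Build _ _ _ lebesgue_cons
  lebesgue_cons0 lebesgue_cons_ge0 lebesgue_cons_sigma_additive.

Let lebesgue_cons_sigma_finite : sigma_finite setT lebesgue_cons.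
Proof.
have /sigma_finiteP[F [TF ndF Foo]] := sigma_finiteT (@lebesgue_measure R).
have /sigma_finiteP[G [TG ndG Goo]] := sigma_finiteT m.
pose fst_rV (x : 'rV[R]_n.+1) : measurableTypeR R := x ord0 ord0.
pose snd_rV (x : 'rV[R]_n.+1) : 'rV[R]_n := \row_j x ord0 (lift ord0 j).
have mfst : measurable_fun setT fst_rV by exact: measurable_coord.
have msnd : measurable_fun setT snd_rV.
  apply/measurable_fun_rVP => i.
  rewrite (_ : (fun _ => _) =
    (fun x : 'rV[R]_n.+1 => x ord0 (lift ord0 i) : measurableTypeR R)).
    exact: measurable_coord.
  by apply/funext => x; rewrite mxE.
exists (fun k => (fst_rV @^-1` F k) `&` (snd_rV @^-1` G k)).
  apply/seteqP; split=> // x _.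
  have [i _ Fi] : (\bigcup_i F i) (fst_rV x) by rewrite -TF.
  have [j _ Gj] : (\bigcup_i G i) (snd_rV x) by rewrite -TG.
  exists (maxn i j) => //; split.
    by have /subsetPset := ndF _ _ (leq_maxl i j); exact.
  by have /subsetPset := ndG _ _ (leq_maxr i j); exact.
move=> k; have [? ?] := Foo k; have [? ?] := Goo k; split.
  apply: measurableI; rewrite -[X in measurable X]setTI.
    exact: mfst.
  exact: msnd.
rewrite /lebesgue_cons /pushforward.
rewrite (_ : _ @^-1` _ = F k `*` G k).
  by rewrite product_measure1E// lte_mul_pinfty// ge0_fin_numE.
have fstK p : fst_rV (cons_rV p) = p.1.
  rewrite /fst_rV (_ : ord0 = lshift n ord0 :> 'I_(1 + n)); last exact/val_inj.
  by apply: (etrans (row_mxEl _ _ _ _)); rewrite mxE.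
have sndK p : snd_rV (cons_rV p) = p.2.
  apply/rowP => j; rewrite mxE.
  rewrite (_ : lift ord0 j = rshift 1 j :> 'I_(1 + n)); last exact/val_inj.
  exact: row_mxEr.
by apply/seteqP; split=> p /=; rewrite fstK sndK.
Qed.

HB.instance Definition _ := Measure_isSigmaFinite.Build _ _ _ lebesgue_cons
  lebesgue_cons_sigma_finite.

End lebesgue_cons.

(* Borel-Lebesgue measure: lambda_0 is the unit mass on the one-point space
   R^0, and lambda_(n+1) is lambda_1 \x lambda_n carried to R^(n+1). *)
Fixpoint borel_lebesgue n : {sigma_finite_measure set 'rV[R]_n -> \bar R} :=
  match n return {sigma_finite_measure set 'rV[R]_n -> \bar R} with
  | 0%N => dirac (0 : 'rV[R]_0)
  | n'.+1 => lebesgue_cons (borel_lebesgue n')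
  end.

End lebesgue_rV.

(* Lebesgue measure on R^d is the completion of the Borel-Lebesgue measure: its
   measurable sets are all the Lebesgue measurable ones, so that the functions
   below are not restricted to Borel functions. *)
Definition lebesgue_rV (R : realType) (d : nat) :=
  @completed_measure_extension _ _ R (@borel_lebesgue R d).

HB.instance Definition _ (R : realType) (d : nat) :=
  Measure.on (@lebesgue_rV R d).

Section euclidean.
Context {R : realType} {d : nat}.
Implicit Types x y : 'rV[R]_d.

Definition dot x y : R := \sum_(i < d) x ord0 i * y ord0 i.

(* The library norm of 'rV[R]_d is the sup norm. *)
Definition enorm x : R := Num.sqrt (dot x x).

(* The filter of the limits |x| --> +oo. *)
Definition at_infinity : set_system 'rV[R]_d :=
  filter_from [set: R] (fun M => [set x | M < enorm x]).

End euclidean.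

Section densities.
Context {R : realType} {d : nat}.
Implicit Types (q : 'rV[R]_d -> \bar R) (f : 'rV[R]_d -> R) (theta : 'rV[R]_d).
Local Open Scope ereal_scope.

Definition L1 q := (@lebesgue_rV R d).-integrable [set: _] q.

Definition lebesgue_int q : \bar R := \int[@lebesgue_rV R d]_y q y.

Definition L1norm f : R := fine (lebesgue_int (fun x => `|f x|%:E)).

Definition density f : Prop :=
  [/\ L1 (EFin \o f), forall x, (0 <= f x)%R
    & ~ {ae @lebesgue_rV R d, forall x, f x = 0%R}].

Definition almost_radial_decreasing f : Prop :=
  exists (g : R -> R) (c : R),
  [/\ forall s, (0 < s)%R -> (0 < g s)%R,
      forall s t, (0 < s)%R -> (s <= t)%R -> (g t <= g s)%R,
      (1 <= c)%R
    & forall x, x != 0%R ->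
        (c^-1 * g (enorm x) <= f x)%R /\ (f x <= c * g (enorm x))%R].

Definition conv q1 q2 : 'rV[R]_d -> \bar R :=
  fun x => lebesgue_int (fun y => q1 (x - y)%R * q2 y).

(* n-fold convolution for n >= 1 (at n = 0 it is also q, which is not used). *)
Definition nconv q n : 'rV[R]_d -> \bar R := iter n.-1 (fun k => conv k q) q.

Definition exp_moment theta (gamma : R) q : \bar R :=
  lebesgue_int (fun y => (expR (gamma * dot theta y))%:E * q y).

(* A quotient a / b of extended reals is a * b^-1, with +oo^-1 = 0, 0^-1 = +oo
   and +oo * 0 = 0; hence, by the case y = 0, this limit forces q (t *: theta)
   to be positive and finite for all large t when q >= 0. *)
Definition shift_limit theta (gamma : R) q : Prop :=
  forall y : 'rV[R]_d,
    q (t *: theta - y)%R / q (t *: theta)%R @[t --> +oo%R]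
      --> (expR (gamma * dot theta y))%:E.

(* The class S_d(theta, gamma). *)
Record subexp_class theta (gamma : R) q : Prop := {
  subexp_L1 : L1 q ;
  subexp_ge0 : forall x, 0 <= q x ;
  subexp_gt0 : exists t0 : R, (0 < t0)%R /\
    forall t : R, (t0 <= t)%R -> 0 < q (t *: theta)%R ;
  subexp_shift : shift_limit theta gamma q ;
  subexp_moment : exp_moment theta gamma q < +oo ;
  subexp_conv :
    nconv q 2 (t *: theta)%R / q (t *: theta)%R @[t --> +oo%R]
      --> 2%:E * exp_moment theta gamma q }.

(* p_lambda, the density of the absolutely continuous part of the compound
   Poisson law built on f, with values in [0, +oo]. *)
Definition poisson_density f (lambda : R) : 'rV[R]_d -> \bar R :=
  fun x => (expR (- (lambda * L1norm f)))%:E *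
    \sum_(1 <= n <oo) (lambda ^+ n / n`!%:R)%:E * nconv (EFin \o f) n x.

End densities.

(* Main.v *)
Require Import Defs.
From HB Require Import structures.
From mathcomp Require Import all_boot all_order all_algebra.
From mathcomp Require Import all_classical all_reals all_analysis.
From mathcomp Require Import measurable_realfun.
From mathcomp Require Import ring lra.

(* Everything is compared with f along the ray t theta. Split a convolution at
   the hyperplane <theta, y> = t / 2: each half is bounded below by Fatou's
   lemma, so a limit of the sum gives the limit of each half. Conversely, once
   f is in the class, Pratt's lemma transfers these limits to all functions
   dominated by f far out that have a limit relative to f along the ray, hence
   to all n-fold convolutions. As the convolution square of f is also almost
   radial (Lebesgue measure is invariant under Householder reflections), f is
   in the class only if f * f = O(f) at infinity, and induction gives a
   geometric bound of the n-fold convolutions by f; with it, Tannery's theorem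
   yields the limit of p_lambda. Conversely, (b) for small lambda bounds f * f
   through the first two terms of the series, and in (c) the square of
   p_lambda dominates that of f. *)

Set Implicit Arguments.
Unset Strict Implicit.
Unset Printing Implicit Defensive.

Import Order.TTheory GRing.Theory Num.Theory.
Import numFieldNormedType.Exports.

Local Open Scope classical_set_scope.
Local Open Scope ring_scope.

(* MathComp-Analysis has another [conv], in convex.v. *)
Local Notation conv := Defs.conv.

(** Three obstacles shape the proof. The hypothesis controls [f] on a single ray, while a
    convolution sees all directions: almost radiality carries bounds, though not limits, from the
    ray to every direction at the cost of a factor [K], so limits stay on the ray and everything off
    it is an inequality. Next, values are pointwise: [f] is not controlled at the origin and
    convolution powers may be infinite near it, so bounds start at norm [1] and real functions are
    recovered by [fine], which changes a power on a null set only and hence no further convolution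
    at any point. Finally, [f] is only Lebesgue measurable, whereas Tonelli's theorem is applied to
    products of Borel measures; each double integral passes to Borel versions, which again leaves
    convolutions unchanged at every point. Fatou's and Pratt's lemmas concern sequences, so limits
    of integrals as [t] grows are tested along sequences [u n] tending to infinity. *)

(** * Completion of a measure: Borel versions and preserving bijections *)

Section completion.
Local Open Scope ereal_scope.
Context d (T : measurableType d) (R : realType).
Variable mu : {measure set T -> \bar R}.
Local Notation cT := (caratheodory_type (mu^*)%mu).
Local Notation cmu := (@completed_measure_extension d T R mu).

Lemma completedE (A : set T) : measurable A -> cmu A = mu A.
Proof. by move=> mA; rewrite /completed_measure_extension measurable_mu_extE. Qed.

Lemma measurable_completed (A : set T) :
  measurable A -> measurable (A : set cT).
Proof. exact: caratheodory_measurable_mu_ext. Qed.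

Lemma measurable_fun_completed d' (T' : measurableType d') (g : T -> T') :
  measurable_fun setT g -> @measurable_fun _ _ cT _ setT g.
Proof.
by move=> mg _ A mA; apply: measurable_completed; exact: mg.
Qed.

(** The identity from the completed space to the original one is measurable and pushes the completed
    measure forward to [mu]. *)
Lemma ge0_integral_completed (q : T -> \bar R) :
  measurable_fun setT q -> (forall x, 0 <= q x) ->
  \int[cmu]_x q x = \int[mu]_x q x.
Proof.
move=> mq q0; pose j : cT -> T := id.
have mj : measurable_fun setT j.
  by move=> _ A mA; rewrite setTI; exact: measurable_completed.
rewrite -[LHS](@ge0_integral_pushforward _ _ cT T R j mj cmu setT q)//.
by apply: eq_measure_integral => mj' A mA; exact: completedE.
Qed.

Let cmu_ge0 (A : set T) : 0 <= cmu A.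
Proof. by apply: mu_ext_ge0 => *; exact: measure_ge0. Qed.

(** Intersect countable measurable covers whose total masses exceed the outer measure by at most
    [1 / n.+1]; if the outer measure is infinite, take the whole space. *)
Lemma outer_hull (A : set T) :
  exists H, [/\ measurable H, A `<=` H & mu H = cmu A].
Proof.
have [Aoo|Aoo] := eqVneq (cmu A) +oo.
  exists setT; split => //; apply/eqP; rewrite eq_le Aoo leey /= -Aoo.
  by rewrite -completedE//; apply: le_outer_measure.
have Afin : cmu A \is a fin_num by rewrite ge0_fin_numE ?cmu_ge0// ltey.
have cover n : exists F : (set T)^nat, measurable_cover A F /\
    \sum_(k <oo) mu (F k) < cmu A + n.+1%:R^-1%:E.
  have n0 : (0 < n.+1%:R^-1 :> R)%R by rewrite invr_gt0.
  by have [_ [F AF <-] ?] := lb_ereal_inf_adherent n0 Afin; exists F.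
have [F FP] := choice cover.
pose H := \bigcap_n \bigcup_k F n k.
have mU n : measurable (\bigcup_k F n k).
  by apply: bigcupT_measurable => k; have [[+ _] _] := FP n.
have mH : measurable H by exact: bigcapT_measurable.
have AH : A `<=` H.
  by move=> x Ax n _; have [[_ +] _] := FP n; apply.
exists H; split => //; apply/eqP; rewrite eq_le; apply/andP; split; last first.
  by rewrite -completedE//; exact: le_outer_measure.
apply/lee_addgt0Pr => _/posnumP[e]; near \oo => n.
apply: (@le_trans _ _ (mu (\bigcup_k F n k))).
  by apply: le_measure; rewrite ?inE//; exact: bigcap_inf.
apply: (@le_trans _ _ (\sum_(k <oo) mu (F n k))).
  by apply: measure_sigma_subadditive => // k; have [[+ _] _] := FP n.
apply: (le_trans (ltW (FP n).2)); rewrite leeD// lee_fin ltW//.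
by near: n; exact: near_infty_natSinv_lt.
Unshelve. all: by end_near. Qed.

Lemma completed_null_hull (A : set T) : cmu A = 0 ->
  exists N, [/\ measurable N, A `<=` N & mu N = 0].
Proof. by move=> A0; have [N []] := outer_hull A; rewrite A0; exists N. Qed.

Hypothesis sfin : sigma_finite setT mu.

(** On a piece of finite measure, the hull exceeds [E] by a null set because [E] is measurable for
    the completion; a hull of this excess is the exceptional set. Sigma-finiteness supplies
    countably many such pieces. *)
Lemma completed_measurable_version (E : set cT) : measurable E ->
  exists F N : set T, [/\ measurable F, measurable N, mu N = 0 &
    forall x, ~ N x -> (E x <-> F x)].
Proof.
move=> mE; have [S ST Soo] := sfin.
have piece n : exists FN : set T * set T, [/\ measurable FN.1, measurable FN.2,
    mu FN.2 = 0 & forall x, ~ FN.2 x -> ((E `&` S n) x <-> FN.1 x)].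
  have [mS Sn] := Soo n.
  have mES : measurable (E `&` S n : set cT).
    by apply: measurableI => //; exact: measurable_completed.
  have ESoo : cmu (E `&` S n) < +oo.
    apply: le_lt_trans Sn; rewrite -completedE//; exact: le_outer_measure.
  have [H [mH EH muH]] := outer_hull (E `&` S n).
  have [|N [mN HN N0]] := @completed_null_hull (H `\` (E `&` S n)).
    have mcH := measurable_completed mH.
    transitivity (cmu H - cmu (H `&` (E `&` S n))).
      rewrite -measureD//; apply: le_lt_trans ESoo.
      by rewrite -muH -completedE.
    rewrite setIidr// [cmu H]completedE// muH subee// ge0_fin_numE//; exact: cmu_ge0.
  exists (H, N); split => //= x Nx; split => [/EH//|Hx].
  by apply: contrapT => Ex; apply/Nx/HN.
have [FN FNP] := choice piece.
exists (\bigcup_n (FN n).1), (\bigcup_n (FN n).2); split.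
- by apply: bigcupT_measurable => n; have [] := FNP n.
- by apply: bigcupT_measurable => n; have [] := FNP n.
- apply/eqP; rewrite eq_le measure_ge0 andbT.
  rewrite (le_trans (measure_sigma_subadditive _ _ _ (@subset_refl _ _)))//.
  + by move=> n; have [] := FNP n.
  + by apply: bigcupT_measurable => n; have [] := FNP n.
  + by rewrite eseries0// => n _ _; have [] := FNP n.
- move=> x Nx; split => [Ex|[n _ Fx]].
    have [n _ Sx] : (\bigcup_n S n) x by rewrite -ST.
    exists n => //; have [_ _ _ /(_ x)[|+ _]] := FNP n; last by apply.
    by move=> ?; apply: Nx; exists n.
  have [_ _ _ /(_ x)[|_ /(_ Fx)[]//]] := FNP n.
  by move=> ?; apply: Nx; exists n.
Qed.

(** A non-negative function is the supremum over rational [r] of [r] times the indicator of its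
    superlevel set at [r]; replace these countably many sets by measurable versions. *)
Lemma completed_fun_version (q : T -> \bar R) :
  @measurable_fun _ _ cT _ setT q -> (forall x, 0 <= q x) ->
  exists (q' : T -> \bar R) (N : set T), [/\ measurable_fun setT q',
    forall x, 0 <= q' x, measurable N, mu N = 0 &
    forall x, ~ N x -> q x = q' x].
Proof.
move=> mq q0.
(* The [r n] run through the rationals; a number that encodes none gives the harmless level [0]. *)
pose r n : R := if unpickle n is Some s then ratr s else 0%R.
have lev n : exists FN : set T * set T, [/\ measurable FN.1, measurable FN.2,
    mu FN.2 = 0 & forall x, ~ FN.2 x -> ((r n)%:E < q x <-> FN.1 x)].
  have [|F [N [mF mN N0 EF]]] :=
      @completed_measurable_version [set x | (r n)%:E < q x].
    have := emeasurable_fun_o_infty measurableT mq (r n)%:E.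
    by rewrite setTI; congr measurable; apply/seteqP; split => x /=;
      rewrite in_itv/= andbT.
  by exists (F, N).
have [FN FNP] := choice lev.
pose u n x : \bar R := ((r n) * \1_((FN n).1) x)%:E.
have mu_ n : measurable_fun setT (u n).
  apply/measurable_EFinP; apply: measurable_funM => //.
  by apply: measurable_indic; have [] := FNP n.
exists (fun x => maxe 0 (ereal_sup (range (u ^~ x)))), (\bigcup_n (FN n).2); split.
- apply: measurable_maxe => //.
  rewrite [X in measurable_fun _ X](_ : _ = fun x => esups (u ^~ x) 0%N).
    exact: measurable_fun_esups.
  by apply/funext => x; rewrite /esups /sdrop/=; congr ereal_sup;
    apply/seteqP; split => _ [n _ <-]; exists n.
- by move=> x; rewrite le_max lexx.
- by apply: bigcupT_measurable => n; have [] := FNP n.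
- apply/eqP; rewrite eq_le measure_ge0 andbT.
  rewrite (le_trans (measure_sigma_subadditive _ _ _ (@subset_refl _ _)))//.
  + by move=> n; have [] := FNP n.
  + by apply: bigcupT_measurable => n; have [] := FNP n.
  + by rewrite eseries0// => n _ _; have [] := FNP n.
move=> x Nx; have Fx n : (r n)%:E < q x <-> (FN n).1 x.
  by have [_ _ _ ] := FNP n; apply => Nnx; apply: Nx; exists n.
apply/eqP; rewrite eq_le; apply/andP; split; last first.
  rewrite ge_max q0/=; apply: ge_ereal_sup => _ [n _ <-].
  rewrite /u indicE; have [/set_mem/Fx/ltW|_] := boolP (x \in (FN n).1).
    by rewrite mulr1.
  by rewrite mulr0.
rewrite le_max; have [->|qx0] := eqVneq (q x) 0; first by rewrite lexx.
apply/orP; right; rewrite leNgt; apply/negP => supq.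
have [a [b [ab sa bq]]] : exists a b : R, [/\ (a < b)%R,
    ereal_sup (range (u ^~ x)) <= a%:E & b%:E <= q x].
  move: supq; case: (ereal_sup _) => [s| |]; last 2 first.
  - by rewrite ltNge leey.
  - case: (q x) (q0 x) qx0 => [t| |]//; last first.
      by exists 0%R, 1%R; rewrite ltr01 leNye leey.
    rewrite lee_fin => t0 _ _; exists (t - 1)%R, t; split => //.
      by rewrite ltrBlDr ltrDl.
    by rewrite leNye.
  case: (q x) (q0 x) => [t| |]//; last first.
    by exists s, (s + 1)%R; rewrite ltrDl ltr01 lexx leey.
  by rewrite lte_fin => _ st; exists s, t.
have [t tab] := rat_in_itvoo ab.
move: tab; rewrite in_itv/= => /andP[at_ tb].
have rt : r (pickle t) = ratr t by rewrite /r pickleK.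
have : u (pickle t) x <= a%:E.
  by apply: le_trans sa; apply: ereal_sup_ubound; exists (pickle t).
have tq : (r (pickle t))%:E < q x by rewrite rt (lt_le_trans _ bq)// lte_fin.
by rewrite /u indicE mem_set ?mulr1; [rewrite rt lee_fin leNgt at_|exact/Fx].
Qed.

Section preserving.
Variables (tau tau' : T -> T).
Hypotheses (mtau : measurable_fun setT tau) (mtau' : measurable_fun setT tau').
Hypotheses (tauK : cancel tau tau') (tau'K : cancel tau' tau).
Hypothesis mutau : forall A, measurable A -> mu (tau @^-1` A) = mu A.

Let mpre A : measurable A -> measurable (tau @^-1` A).
Proof. by move=> mA; rewrite -[X in measurable X]setTI; exact: mtau. Qed.

Let mpre' A : measurable A -> measurable (tau' @^-1` A).
Proof. by move=> mA; rewrite -[X in measurable X]setTI; exact: mtau'. Qed.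

(** Each inequality covers a set by its measurable hull, on which [tau] is known to preserve the
    measure; for the second one, the hull of the preimage is moved back by [tau']. Thus arbitrary
    sets keep their outer measure. *)
Lemma completed_preserving (A : set T) : cmu (tau @^-1` A) = cmu A.
Proof.
apply/eqP; rewrite eq_le; apply/andP; split.
  have [H [mH AH <-]] := outer_hull A.
  rewrite -mutau// -completedE; last exact: mpre.
  by apply: le_outer_measure; exact: preimage_subset.
have [H [mH AH <-]] := outer_hull (tau @^-1` A).
rewrite (_ : H = tau @^-1` (tau' @^-1` H)); last first.
  by apply/seteqP; split => x /=; rewrite tauK.
rewrite mutau; last exact: mpre'.
rewrite -completedE; last exact: mpre'.
apply: le_outer_measure => x Ax; apply: AH => /=; by rewrite tau'K.
Qed.

(** The Caratheodory criterion involves outer measures only, and every test set is a preimage since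
    [tau] is bijective. *)
Lemma measurable_preserving : @measurable_fun _ _ cT cT setT tau.
Proof.
move=> _ A /= mA; rewrite setTI.
suff: (mu^*)%mu.-caratheodory (tau @^-1` A) by [].
have {}mA : (mu^*)%mu.-caratheodory A by [].
move=> X.
have XE : X = tau @^-1` (tau' @^-1` X).
  by apply/seteqP; split => x /=; rewrite tauK.
have P B : (mu^*)%mu (tau @^-1` B) = (mu^*)%mu B by exact: completed_preserving.
by rewrite {1 2 3}XE preimage_setC -!preimage_setI !P; exact: mA.
Qed.

Lemma measurable_fun_preserving d' (T' : measurableType d') (g : T -> T') :
  @measurable_fun _ _ cT _ setT g -> @measurable_fun _ _ cT _ setT (g \o tau).
Proof.
by move=> mg; apply: (measurableT_comp mg); exact: measurable_preserving.
Qed.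

Lemma ge0_integral_preserving (q : T -> \bar R) :
  @measurable_fun _ _ cT _ setT q -> (forall x, 0 <= q x) ->
  \int[cmu]_x q (tau x) = \int[cmu]_x q x.
Proof.
move=> mq q0.
rewrite -(@ge0_integral_pushforward _ _ cT cT R tau measurable_preserving
  cmu setT q)//.
apply: eq_measure_integral => [|mt A _ _]; first exact: measurable_preserving.
exact: completed_preserving.
Qed.

End preserving.

End completion.

(** * Borel-Lebesgue measure: reflections, cubes and uniqueness up to a factor *)

Section borel_lebesgue_theory.
Context {R : realType}.
Local Open Scope ereal_scope.

(** By uniqueness it suffices to look at half-open intervals; the reflection moves the closed end to
    the other side, which the length does not see. *)
Lemma lebesgue_measure_refl (a : R) (A : set (measurableTypeR R)) :
  measurable A ->
  lebesgue_measure ((fun x : measurableTypeR R => (a - x)%R) @^-1` A) =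
  lebesgue_measure A.
Proof.
have mr : measurable_fun setT
    (fun x : measurableTypeR R => (a - x)%R : measurableTypeR R).
  exact: (@measurable_funB _ _ _ setT (cst a) (@id R)).
move=> mA; apply/esym.
apply: (@lebesgue_measure_unique R (pushforward lebesgue_measure
  (fun x : measurableTypeR R => (a - x)%R : measurableTypeR R))) => //.
move=> _ [[p q] _ <-]; rewrite [RHS](_ : _ =
    lebesgue_measure (`[(a - q)%R, (a - p)%R[%classic : set R)); last first.
  rewrite /= /pushforward; congr (lebesgue_measure _).
  by apply/seteqP; split => x /=; rewrite !in_itv/= => /andP[? ?];
    apply/andP; split; lra.
rewrite !lebesgue_measure_itv/= !lte_fin ltrD2l ltrN2.
by case: ifP => // _; rewrite -!EFinD; congr EFin; lra.
Qed.

Lemma measurable_fun_subrV d (T : measurableType d) n (g h : T -> 'rV[R]_n) :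
  measurable_fun setT g -> measurable_fun setT h ->
  measurable_fun setT (fun x => g x - h x)%R.
Proof.
move=> /measurable_fun_rVP mg /measurable_fun_rVP mh.
apply/measurable_fun_rVP => i.
rewrite (_ : (fun _ => _) = (fun x => g x ord0 i - h x ord0 i)%R).
  by apply: measurable_funB; [exact: mg|exact: mh].
by apply/funext => x; rewrite !mxE.
Qed.

Lemma measurable_refl n (a : 'rV[R]_n) :
  measurable_fun setT (fun y : 'rV[R]_n => a - y)%R.
Proof. by apply: measurable_fun_subrV. Qed.

Lemma measurable_refl_preimage n (a : 'rV[R]_n) (A : set 'rV[R]_n) :
  measurable A -> measurable ((fun y => a - y)%R @^-1` A).
Proof.
by move=> mA; rewrite -[X in measurable X]setTI; exact: measurable_refl.
Qed.

Lemma cons_rV0 n (p : measurableTypeR R * 'rV[R]_n) :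
  cons_rV p ord0 ord0 = p.1.
Proof.
rewrite (_ : ord0 = lshift n ord0 :> 'I_(1 + n)); last exact/val_inj.
by apply: (etrans (row_mxEl _ _ _ _)); rewrite mxE.
Qed.

Lemma cons_rV_lift n (p : measurableTypeR R * 'rV[R]_n) j :
  cons_rV p ord0 (lift ord0 j) = p.2 ord0 j.
Proof.
rewrite (_ : lift ord0 j = rshift 1 j :> 'I_(1 + n)); last exact/val_inj.
exact: row_mxEr.
Qed.

(** Induction on the dimension, slicing along the first coordinate. Reflections are the
    substitutions that convolutions require, and a translation is a composite of two of them. *)
Lemma borel_lebesgue_refl n (a : 'rV[R]_n) (A : set 'rV[R]_n) : measurable A ->
  borel_lebesgue n ((fun y => a - y)%R @^-1` A) = borel_lebesgue n A.
Proof.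
elim: n a A => [a A mA|n IH a A mA].
  congr (borel_lebesgue _ _); apply/seteqP.
  by split => y /=; rewrite (thinmx0 (a - y)%R) (thinmx0 y).
pose a0 := a ord0 ord0; pose a' : 'rV[R]_n := \row_j a ord0 (lift ord0 j).
have aE x y : (a - cons_rV (x, y))%R = cons_rV ((a0 - x)%R, (a' - y)%R).
  apply/rowP => i; have [j ->|->] := unliftP ord0 i.
    by rewrite cons_rV_lift [LHS]mxE [X in (_ + X)%R]mxE cons_rV_lift !mxE.
  by rewrite cons_rV0 [LHS]mxE [X in (_ + X)%R]mxE cons_rV0.
pose B : set (measurableTypeR R * 'rV[R]_n) := @cons_rV R n @^-1` A.
have mB : measurable B.
  by rewrite -[X in measurable X]setTI; exact: measurable_cons_rV.
pose F x := borel_lebesgue n (xsection B x).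
have mF : measurable_fun setT F by exact: measurable_fun_xsection.
have mr0 : measurable_fun setT
    (fun x : measurableTypeR R => (a0 - x)%R : measurableTypeR R).
  exact: (@measurable_funB _ _ _ setT (cst a0) (@id R)).
transitivity (\int[@lebesgue_measure R]_x F (a0 - x)%R).
  apply: eq_integral => x _; rewrite /= /F -(IH a'); last first.
    exact: measurable_xsection.
  congr (borel_lebesgue n _); apply/seteqP; split => y /=;
    by rewrite /xsection /= !inE /B /= -aE.
rewrite -(@ge0_integral_pushforward _ _ _ _ R _ mr0 lebesgue_measure setT F)//.
apply: eq_measure_integral => C mC _; exact: lebesgue_measure_refl.
Qed.

Definition cube (n : nat) (a b : R) : set 'rV[R]_n :=
  [set x | forall i, (a <= x ord0 i <= b)%R].
Arguments cube : clear implicits.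

Lemma borel_lebesgue_cube n (a b : R) : (a <= b)%R ->
  measurable (cube n a b) /\ borel_lebesgue n (cube n a b) = ((b - a) ^+ n)%:E.
Proof.
move=> ab; elim: n => [|n [mc IH]].
  have -> : cube 0 a b = setT by apply/seteqP; split => // x _ [].
  by split=> //; rewrite expr0 /= diracT.
have mc1 : measurable (cube n.+1 a b).
  rewrite (_ : cube _ _ _ = \bigcap_(i in [set: 'I_n.+1])
      (fun x : 'rV[R]_n.+1 => x ord0 i : measurableTypeR R) @^-1` `[a, b]%classic).
    apply: fin_bigcap_measurable => // i _.
    by rewrite -[X in measurable X]setTI; exact: measurable_coord.
  by apply/seteqP; split => x xab i; [move=> _|]; have := xab i;
    rewrite /= in_itv/=; exact.
split=> //; rewrite /= /lebesgue_cons /pushforward.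
rewrite (_ : _ @^-1` _ = `[a, b]%classic `*` cube n a b).
  rewrite product_measure1E// [X in _ * X]IH.
  rewrite [X in X * _](_ : _ = (b - a)%:E); first by rewrite -EFinM -exprS.
  rewrite -[LHS]/(lebesgue_measure _) lebesgue_measure_itv/= lte_fin.
  by have [_|ba] := ltP; [rewrite EFinB|rewrite (@le_anti _ _ a b) ?ab// subrr].
apply/seteqP; split => [[x y] /= xy|[x y] /= [+ xy] i].
  split; first by have := xy ord0; rewrite in_itv/= cons_rV0.
  by move=> i; have := xy (lift ord0 i); rewrite cons_rV_lift.
rewrite in_itv/= => xab; have [j ->|->] := unliftP ord0 i.
  by rewrite cons_rV_lift.
by rewrite cons_rV0.
Qed.

(* Unimodular case of the uniqueness of Haar measure: Tonelli applied to
   [1_A x * 1_B (x - y)] exchanges the roles of the two measures. *)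
Lemma haar_exchange n (mu nu : {sigma_finite_measure set 'rV[R]_n -> \bar R})
    (A B : set 'rV[R]_n) :
  (forall (a : 'rV[R]_n) (C : set 'rV[R]_n), measurable C ->
    mu ((fun y => a - y)%R @^-1` C) = mu C) ->
  (forall (a : 'rV[R]_n) (C : set 'rV[R]_n), measurable C ->
    nu ((fun y => a - y)%R @^-1` C) = nu C) ->
  measurable A -> measurable B -> nu A * mu B = mu A * nu B.
Proof.
move=> muI nuI mA mB.
pose ind (C : set 'rV[R]_n) x : \bar R := (\1_C x)%:E.
have mind C : measurable C -> measurable_fun setT (ind C).
  by move=> mC; apply/measurable_EFinP; exact: measurable_indic.
have iind (m : {measure set 'rV[R]_n -> \bar R}) C : measurable C ->
    \int[m]_x ind C x = m C.
  by move=> mC; rewrite /ind integral_indic// setIT.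
have ind0 C x : 0 <= ind C x by rewrite lee_fin.
pose u (p : 'rV[R]_n * 'rV[R]_n) := ind A p.1 * ind B (p.1 - p.2)%R.
have mdiff : measurable_fun setT
    (fun p : 'rV[R]_n * 'rV[R]_n => p.1 - p.2)%R.
  by apply: measurable_fun_subrV; [exact: measurable_fst|exact: measurable_snd].
have m_u : measurable_fun setT u.
  apply: emeasurable_funM.
    by apply: (measurableT_comp (mind A mA)); exact: measurable_fst.
  exact: (measurableT_comp (mind B mB)).
have u0 p : 0 <= u p by rewrite mule_ge0.
have := @fubini_tonelli _ _ _ _ R nu mu u m_u u0.
have -> : \int[nu]_x \int[mu]_y u (x, y) = nu A * mu B.
  transitivity (\int[nu]_x (ind A x * mu B)).
    apply: eq_integral => x _; rewrite /u/= ge0_integralZl//; last first.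
      exact: (measurableT_comp (mind B mB) (measurable_refl x)).
    congr (_ * _); rewrite -(muI x B)//.
    exact: (iind mu _ (measurable_refl_preimage x mB)).
  by rewrite ge0_integralZr ?iind//; exact: mind.
move=> ->.
have transl (a : 'rV[R]_n) (C : set 'rV[R]_n) : measurable C ->
    nu ((fun x => x + a)%R @^-1` C) = nu C.
  move=> mC; rewrite -[RHS](nuI a C mC) -[RHS](nuI 0%R); last first.
    exact: measurable_refl_preimage.
  by congr (nu _); apply/seteqP; split => x /=; rewrite sub0r opprK addrC.
have BN : measurable (-%R @^-1` B).
  rewrite (_ : -%R = fun y => 0 - y)%R; first exact: measurable_refl_preimage.
  by apply/funext => y; rewrite sub0r.
(* The substitution of [y - x] for [x] in the inner integral leaves [y] in the factor of [A] only,
   so that integrating in [y] now yields [mu A]. *)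
transitivity (\int[mu]_y \int[nu]_x (ind A (y - x)%R * ind (-%R @^-1` B) x)).
  apply: eq_integral => y _.
  pose g x := ind A x * ind B (x - y)%R.
  have mg : measurable_fun setT g.
    apply: emeasurable_funM; first exact: mind.
    by apply: (measurableT_comp (mind B mB)); apply: measurable_fun_subrV.
  transitivity (\int[nu]_x (g (y - x)%R)).
    rewrite -(@ge0_integral_pushforward _ _ _ _ R _ (measurable_refl y) nu setT g)//.
      rewrite -[LHS]/(\int[nu]_x g x).
      apply: eq_measure_integral => [|mr C mC _]; first exact: measurable_refl.
      by apply/esym; exact: nuI.
    by move=> x _; rewrite mule_ge0.
  apply: eq_integral => x _; rewrite /g /ind; congr (_ * _); congr EFin.
  rewrite (_ : y - x - y = - x)%R; last by rewrite addrAC subrr add0r.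
  suff e : (x \in -%R @^-1` B) = ((- x)%R \in B) by rewrite !indicE e.
  by apply/idP/idP => /set_mem ?; exact/mem_set.
pose v (p : 'rV[R]_n * 'rV[R]_n) := ind A (p.2 - p.1)%R * ind (-%R @^-1` B) p.1.
have mdiff' : measurable_fun setT
    (fun p : 'rV[R]_n * 'rV[R]_n => p.2 - p.1)%R.
  by apply: measurable_fun_subrV; [exact: measurable_snd|exact: measurable_fst].
have m_v : measurable_fun setT v.
  apply: emeasurable_funM; first exact: (measurableT_comp (mind A mA)).
  by apply: (measurableT_comp (mind _ BN)); exact: measurable_fst.
have v0 p : 0 <= v p by rewrite mule_ge0.
rewrite -[LHS](@fubini_tonelli _ _ _ _ R nu mu v m_v v0).
transitivity (\int[nu]_x (mu A * ind (-%R @^-1` B) x)).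
  apply: eq_integral => x _; rewrite /v/= ge0_integralZr//; last first.
    by apply: (measurableT_comp (mind A mA)); apply: measurable_fun_subrV.
  congr (_ * _).
  have -> : mu A = mu ((fun y => y - x)%R @^-1` A).
    rewrite -[LHS](muI (- x)%R A mA) -[LHS](muI 0%R); last first.
      exact: measurable_refl_preimage.
    by congr (mu _); apply/seteqP; split => y /=; rewrite sub0r opprK addrC.
  apply: (iind mu ((fun y => y - x)%R @^-1` A)).
  by rewrite -[X in measurable X]setTI; apply: measurable_fun_subrV.
rewrite ge0_integralZl//; last exact: mind.
rewrite iind//; congr (_ * _).
rewrite -(nuI 0%R B mB); congr (nu _).
by apply/seteqP; split => x /=; rewrite sub0r.
Qed.

End borel_lebesgue_theory.
Arguments cube {R} n a b.

(** * Euclidean geometry and Householder reflections *)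

Section euclidean_geometry.
Context {R : realType} {d : nat}.
Implicit Types (x y z u : 'rV[R]_d) (a : R).

Lemma dotC x y : dot x y = dot y x.
Proof. by apply: eq_bigr => i _; rewrite mulrC. Qed.

Lemma dotDl x y z : dot (x + y) z = dot x z + dot y z.
Proof. by rewrite -big_split; apply: eq_bigr => i _ /=; rewrite mxE mulrDl. Qed.

Lemma dotZl a x y : dot (a *: x) y = a * dot x y.
Proof. by rewrite mulr_sumr; apply: eq_bigr => i _; rewrite mxE mulrA. Qed.

Lemma dotNl x y : dot (- x) y = - dot x y.
Proof. by rewrite -scaleN1r dotZl mulN1r. Qed.

Lemma dotBl x y z : dot (x - y) z = dot x z - dot y z.
Proof. by rewrite dotDl dotNl. Qed.

Lemma dotDr x y z : dot x (y + z) = dot x y + dot x z.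
Proof. by rewrite !(dotC x) dotDl. Qed.

Lemma dotZr a x y : dot x (a *: y) = a * dot x y.
Proof. by rewrite !(dotC x) dotZl. Qed.

Lemma dotNr x y : dot x (- y) = - dot x y.
Proof. by rewrite !(dotC x) dotNl. Qed.

Lemma dotBr x y z : dot x (y - z) = dot x y - dot x z.
Proof. by rewrite dotDr dotNr. Qed.

Lemma dot0r x : dot x 0 = 0.
Proof. by rewrite -(scale0r x) dotZr mul0r. Qed.

Lemma dot_ge0 x : 0 <= dot x x.
Proof. by apply: sumr_ge0 => i _; rewrite -expr2 sqr_ge0. Qed.

Lemma le_coord_dot x i : x ord0 i ^+ 2 <= dot x x.
Proof.
rewrite /dot (bigD1 i)//= -expr2 lerDl.
by apply: sumr_ge0 => j _; rewrite -expr2 sqr_ge0.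
Qed.

Lemma dot_eq0 x : dot x x = 0 -> x = 0.
Proof.
move=> x0; apply/rowP => i; rewrite mxE; apply/eqP.
by rewrite -sqrf_eq0 eq_le sqr_ge0 andbT -x0 le_coord_dot.
Qed.

Lemma enorm_ge0 x : 0 <= enorm x.
Proof. exact: sqrtr_ge0. Qed.

Lemma sqr_enorm x : enorm x ^+ 2 = dot x x.
Proof. by rewrite sqr_sqrtr// dot_ge0. Qed.

Lemma enorm0 : enorm (0 : 'rV[R]_d) = 0.
Proof. by rewrite /enorm dot0r sqrtr0. Qed.

Lemma enorm_eq0 x : enorm x = 0 -> x = 0.
Proof. by move=> x0; apply: dot_eq0; rewrite -sqr_enorm x0 expr0n. Qed.

Lemma enorm_gt0 x : (0 < enorm x) = (x != 0).
Proof.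
rewrite lt0r enorm_ge0 andbT; apply/idP/idP; apply: contraNneq.
  by move=> ->; rewrite enorm0.
by move=> x0; apply/eqP/enorm_eq0.
Qed.

Lemma enormZ a x : enorm (a *: x) = `|a| * enorm x.
Proof.
by rewrite /enorm dotZl dotZr mulrA -expr2 sqrtrM ?sqr_ge0// sqrtr_sqr.
Qed.

(** Cauchy-Schwarz: with [X] and [Y] the norms and [D] the product, the vector [Y *: x - X *: y] has
    square [2 * (X * Y) * (X * Y - D)]. *)
Lemma dot_le x y : dot x y <= enorm x * enorm y.
Proof.
have [->|y0] := eqVneq y 0; first by rewrite dot0r enorm0 mulr0.
have [->|x0] := eqVneq x 0.
  by rewrite dotC dot0r enorm0 mul0r.
have px : 0 < enorm x by rewrite enorm_gt0.
have py : 0 < enorm y by rewrite enorm_gt0.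
have := dot_ge0 (enorm y *: x - enorm x *: y).
rewrite !(dotBl, dotBr, dotZl, dotZr) -!sqr_enorm (dotC y x).
set X := enorm x in px *; set Y := enorm y in py *; set D := dot x y => h.
have : 0 <= (2 * (X * Y)) * (X * Y - D) by move: h; congr (_ <= _); ring.
by rewrite pmulr_rge0 ?subr_ge0// mulr_gt0// mulr_gt0.
Qed.

Lemma enormD x y : enorm (x + y) <= enorm x + enorm y.
Proof.
rewrite -(@ler_pXn2r _ 2) ?nnegrE ?addr_ge0 ?enorm_ge0//.
rewrite sqr_enorm dotDl !dotDr -!sqr_enorm (dotC y x) sqrrD.
by have := dot_le x y; lra.
Qed.

Lemma enorm_sub_ge x y : enorm x - enorm y <= enorm (x - y).
Proof. by rewrite lerBlDr -{1}(subrK y x) enormD. Qed.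

Lemma le_coord_enorm x i : `|x ord0 i| <= enorm x.
Proof.
rewrite -(@ler_pXn2r _ 2) ?nnegrE ?enorm_ge0//.
by rewrite real_normK ?num_real// sqr_enorm le_coord_dot.
Qed.

Lemma enorm_le_coord (r : R) x : (forall i, `|x ord0 i| <= r) ->
  enorm x <= d%:R * r.
Proof.
move=> xr; have [d0|d0] := posnP d.
  rewrite (_ : x = 0) ?enorm0 ?d0 ?mul0r//.
  apply/rowP => i.
  by exfalso; have := leq_ltn_trans (leq0n i) (ltn_ord i); rewrite d0.
have r0 : 0 <= r by rewrite (le_trans _ (xr (Ordinal d0))).
rewrite -(@ler_pXn2r _ 2) ?nnegrE ?enorm_ge0 ?mulr_ge0//.
rewrite sqr_enorm; apply: (@le_trans _ _ (\sum_(i < d) r ^+ 2)).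
  apply: ler_sum => i _; rewrite -expr2 -(real_normK (num_real _)).
  by rewrite ler_pXn2r ?nnegrE.
rewrite sumr_const card_ord -[X in X <= _]mulr_natl exprMn ler_wpM2r ?sqr_ge0//.
by rewrite -natrX ler_nat expnS leq_pmulr// expn1.
Qed.

Lemma measurable_dotl u : measurable_fun setT (dot u).
Proof.
apply: measurable_sum => i; apply: measurable_funM => //.
exact: (measurable_coord i).
Qed.

Lemma measurable_enorm : measurable_fun setT (@enorm R d).
Proof.
rewrite (_ : enorm = Num.sqrt \o (fun x => dot x x))//.
apply: measurableT_comp.
  by apply: continuous_measurable_fun => x; exact: sqrt_continuous.
by apply: measurable_sum => i; apply: measurable_funM;
  exact: (measurable_coord i).
Qed.

(** The reflection in the hyperplane orthogonal to [u]. For [u = 0] it is the identity, so that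
    [householder_swap] also covers equal points. *)
Definition householder u y : 'rV[R]_d := y - (2 * dot u y / dot u u) *: u.

Lemma householderB u x y :
  householder u (x - y) = householder u x - householder u y.
Proof.
rewrite /householder dotBr mulrBr mulrBl scalerBl !opprB !addrA.
by rewrite [RHS]addrAC [LHS]addrAC (addrAC x (- y)).
Qed.

Lemma dot_householder u y : dot (householder u y) (householder u y) = dot y y.
Proof.
rewrite /householder !(dotBl, dotBr, dotZl, dotZr) (dotC y u).
have [/dot_eq0->|u0] := eqVneq (dot u u) 0.
  by rewrite !(dotC 0) !dot0r; lra.
by field.
Qed.

Lemma enorm_householder u y : enorm (householder u y) = enorm y.
Proof. by rewrite /enorm dot_householder. Qed.

Lemma householderK u : involutive (householder u).
Proof.
move=> y; rewrite /householder dotBr dotZr.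
have [/dot_eq0->|u0] := eqVneq (dot u u) 0; first by rewrite !scaler0 !subr0.
rewrite -addrA -opprD -scalerDl.
have -> : 2 * dot u y / dot u u +
    2 * (dot u y - 2 * dot u y / dot u u * dot u u) / dot u u = 0 by field.
by rewrite scale0r subr0.
Qed.

(** For equal norms the bisecting hyperplane of [x] and [y] passes through the origin;
    algebraically, the coefficient of [x - y] is [1]. *)
Lemma householder_swap x y : enorm x = enorm y -> householder (x - y) x = y.
Proof.
move=> xy; have dxy : dot x x = dot y y by rewrite -!sqr_enorm xy.
have [/dot_eq0|u0] := eqVneq (dot (x - y) (x - y)) 0.
  move=> xy0; rewrite /householder xy0 scaler0 subr0.
  by apply/eqP; rewrite -subr_eq0 xy0.
rewrite /householder (_ : _ / _ = 1); last first.
  move: u0; rewrite !(dotBl, dotBr) (dotC y x) dxy => u0.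
  by rewrite -[RHS](divff u0); congr (_ / _); ring.
by rewrite scale1r opprB addrC subrK.
Qed.

Lemma measurable_householder u : measurable_fun setT (householder u).
Proof.
apply: measurable_fun_subrV => //; apply/measurable_fun_rVP => i.
rewrite (_ : (fun _ => _) =
    (fun y => (2 * dot u y / dot u u) * u ord0 i)); last first.
  by apply/funext => y; rewrite mxE.
apply: measurable_funM => //; apply: measurable_funM => //.
by apply: measurable_funM => //; exact: measurable_dotl.
Qed.

End euclidean_geometry.

(** * Balls and invariance under Householder reflections *)

Section borel_lebesgue_ball.
Context {R : realType} {d : nat}.
Local Open Scope ereal_scope.

Definition eball (r : R) : set 'rV[R]_d := [set x | (enorm x <= r)%R].

Lemma measurable_eball r : measurable (eball r).
Proof.
rewrite (_ : eball r = @enorm R d @^-1` `]-oo, r]%classic).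
  rewrite -[X in measurable X]setTI; apply: measurable_enorm => //.
by apply/seteqP; split => x /=; rewrite in_itv.
Qed.

Lemma borel_lebesgue_ball_lty r : borel_lebesgue d (eball r) < +oo.
Proof.
have [r0|r0] := leP 0%R r; last first.
  rewrite (_ : eball r = set0) ?measure0//; apply/seteqP; split => // x /=.
  by rewrite /eball/= leNgt (lt_le_trans r0)// enorm_ge0.
have [|mc mu] := @borel_lebesgue_cube R d (- r) r; first by rewrite ge0_cp.
apply: (@le_lt_trans _ _ (borel_lebesgue d (cube d (- r) r))).
  apply: le_measure; rewrite ?inE//; first exact: measurable_eball.
  by move=> x xr i; rewrite -ler_norml (le_trans (le_coord_enorm _ _)).
by rewrite mu ltry.
Qed.

Lemma borel_lebesgue_ball_gt0 r : (0 < r)%R -> 0 < borel_lebesgue d (eball r).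
Proof.
(* The cube of side [s] lies in the ball since [d%:R * s <= r]; the divisor [d.+1] keeps [s]
   positive for [d = 0] as well. *)
move=> r0; pose s := (r / d.+1%:R)%R.
have s0 : (0 < s)%R by rewrite divr_gt0.
have [|mc mu] := @borel_lebesgue_cube R d 0 s; first exact: ltW.
apply: (@lt_le_trans _ _ (borel_lebesgue d (cube d 0 s))).
  by rewrite mu subr0 lte_fin exprn_gt0.
apply: le_measure; rewrite ?inE//; first exact: measurable_eball.
move=> x xs; rewrite /eball/= (@le_trans _ _ (d%:R * s))%R//.
  apply: enorm_le_coord => i; have /andP[? ?] := xs i.
  by rewrite ger0_norm.
by rewrite /s mulrCA ger_pMr// ler_pdivrMr// mul1r ler_nat.
Qed.

(** The reflection is additive, so the pushforward measure is again invariant under the maps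
    [a - y], and [haar_exchange] makes it proportional to the original. The unit ball, which is
    mapped to itself and has positive finite measure, shows that the factor is [1]; no determinant
    enters. *)
Lemma borel_lebesgue_householder u (A : set 'rV[R]_d) : measurable A ->
  borel_lebesgue d (householder u @^-1` A) = borel_lebesgue d A.
Proof.
move=> mA; have mh := measurable_householder u.
have mpre B : measurable B -> measurable (householder u @^-1` B).
  by move=> mB; rewrite -[X in measurable X]setTI; exact: mh.
pose nu0 : {measure set 'rV[R]_d -> \bar R} :=
  measure_function_pushforward__canonical__measure_function_Measure
    (borel_lebesgue d) mh.
have sf : sigma_finite setT nu0.
  have [F TF Foo] := sigma_finiteT (@borel_lebesgue R d).
  exists (fun n => householder u @^-1` F n).
    by rewrite -preimage_bigcup -TF preimage_setT.
  move=> n; have [mF ?] := Foo n; split; first exact: mpre.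
  rewrite /nu0/= /pushforward -comp_preimage (_ : _ \o _ = id)//.
  by apply/funext => x; exact: householderK.
pose nu : {sigma_finite_measure set 'rV[R]_d -> \bar R} :=
  HB.pack_for {sigma_finite_measure set 'rV[R]_d -> \bar R}
    (Measure.sort nu0) (Measure_isSigmaFinite.Build _ _ _ nu0 sf).
have nuI (a : 'rV[R]_d) (C : set 'rV[R]_d) : measurable C ->
    nu ((fun y => a - y)%R @^-1` C) = nu C.
  move=> mC; rewrite -[LHS]/(borel_lebesgue d (householder u @^-1` _)).
  rewrite -[RHS]/(borel_lebesgue d (householder u @^-1` _)).
  rewrite -[RHS](borel_lebesgue_refl (householder u a)); last exact: mpre.
  congr (borel_lebesgue d _); apply/seteqP.
  by split => y /=; rewrite householderB householderK.
have := @haar_exchange R d (borel_lebesgue d) nu A (eball 1)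
  (@borel_lebesgue_refl R d) nuI mA (measurable_eball 1).
have -> : nu (eball 1) = borel_lebesgue d (eball 1).
  rewrite -[LHS]/(borel_lebesgue d (householder u @^-1` _)).
  by congr (borel_lebesgue d _); apply/seteqP; split => x /=;
    rewrite /eball/= enorm_householder.
have Bfin : borel_lebesgue d (eball 1) \is a fin_num.
  by rewrite ge0_fin_numE ?borel_lebesgue_ball_lty.
have B0 : 0 < borel_lebesgue d (eball 1) by exact: borel_lebesgue_ball_gt0.
move=> E; have {}E : borel_lebesgue d (householder u @^-1` A) *
  borel_lebesgue d (eball 1) = borel_lebesgue d A * borel_lebesgue d (eball 1).
  exact: E.
apply/eqP; rewrite eq_le.
by apply/andP; split; rewrite -(lee_pmul2r Bfin B0) E.
Qed.

End borel_lebesgue_ball.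

(** * Lebesgue measurable functions, convolutions and exponential moments *)

Section lebesgue_functions.
Context {R : realType} {d : nat}.
Local Open Scope ereal_scope.
Local Notation V := 'rV[R]_d.
Local Notation LV := (caratheodory_type ((@borel_lebesgue R d)^*)%mu).
Implicit Types (q : V -> \bar R) (x z u theta : V).

(** Row vectors carry the Borel sigma-algebra, so a plain [measurable_fun] means Borel; the alias
    [LV] of the domain carries the Lebesgue measurable sets instead. *)
Definition lmeas d' (U : measurableType d') (q : V -> U) : Prop :=
  @measurable_fun _ _ LV U setT q.

Lemma lmeas_borel d' (U : measurableType d') (q : V -> U) :
  measurable_fun setT q -> lmeas q.
Proof. exact: measurable_fun_completed. Qed.

Lemma reflK x : involutive (fun y : V => x - y)%R.
Proof. by move=> y; rewrite opprB addrC subrK. Qed.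

Lemma lmeas_refl d' (U : measurableType d') (q : V -> U) x :
  lmeas q -> lmeas (fun y => q (x - y)%R).
Proof.
by apply: (measurable_fun_preserving (measurable_refl x) (measurable_refl x)
  (reflK x) (reflK x) (borel_lebesgue_refl x)).
Qed.

Lemma lint_refl q x : lmeas q -> (forall y, 0 <= q y) ->
  lebesgue_int (fun y => q (x - y)%R) = lebesgue_int q.
Proof.
by apply: (ge0_integral_preserving (measurable_refl x) (measurable_refl x)
  (reflK x) (reflK x) (borel_lebesgue_refl x)).
Qed.

Lemma lmeas_shift d' (U : measurableType d') (q : V -> U) z :
  lmeas q -> lmeas (fun y => q (y - z)%R).
Proof.
move=> mq; rewrite (_ : (fun y => _) = fun y => q (0 - (z - y))%R).
  exact: (@lmeas_refl _ _ (fun w => q (0 - w)%R) z (lmeas_refl 0 mq)).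
by apply/funext => y; rewrite sub0r opprB.
Qed.

Lemma lint_shift q z : lmeas q -> (forall y, 0 <= q y) ->
  lebesgue_int (fun y => q (y - z)%R) = lebesgue_int q.
Proof.
move=> mq q0; rewrite -(@lint_refl q 0%R)//.
rewrite -(@lint_refl (fun w => q (0 - w)%R) z)//; last exact: lmeas_refl.
by congr lebesgue_int; apply/funext => y; rewrite sub0r opprB.
Qed.

Lemma lmeas_householder d' (U : measurableType d') (q : V -> U) u :
  lmeas q -> lmeas (q \o householder u).
Proof.
by apply: (measurable_fun_preserving (measurable_householder u)
  (measurable_householder u) (householderK u) (householderK u)
  (borel_lebesgue_householder u)).
Qed.

Lemma lint_householder q u : lmeas q -> (forall y, 0 <= q y) ->
  lebesgue_int (fun y => q (householder u y)) = lebesgue_int q.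
Proof.
by apply: (ge0_integral_preserving (measurable_householder u)
  (measurable_householder u) (householderK u) (householderK u)
  (borel_lebesgue_householder u)).
Qed.

Lemma lint_borel q : measurable_fun setT q -> (forall y, 0 <= q y) ->
  lebesgue_int q = \int[borel_lebesgue d]_y q y.
Proof. exact: ge0_integral_completed. Qed.

Lemma le_lint q q' : lmeas q -> lmeas q' -> (forall y, 0 <= q y) ->
  (forall y, q y <= q' y) -> lebesgue_int q <= lebesgue_int q'.
Proof.
move=> mq mq' q0 qq'; by apply: ge0_le_integral.
Qed.

Lemma lint_ge0 q : (forall y, 0 <= q y) -> 0 <= lebesgue_int q.
Proof. by move=> q0; apply: integral_ge0. Qed.

Lemma lintZl q (k : \bar R) : lmeas q -> (forall y, 0 <= q y) -> 0 <= k ->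
  lebesgue_int (fun y => k * q y) = k * lebesgue_int q.
Proof. by move=> mq q0 k0; rewrite /lebesgue_int ge0_integralZl. Qed.

Lemma lintD q q' : lmeas q -> lmeas q' -> (forall y, 0 <= q y) ->
  (forall y, 0 <= q' y) ->
  lebesgue_int (fun y => q y + q' y) = lebesgue_int q + lebesgue_int q'.
Proof. by move=> mq mq' q0 q'0; rewrite /lebesgue_int ge0_integralD. Qed.

Lemma ae_lebesgueS (P Q : V -> Prop) : (forall y, P y -> Q y) ->
  {ae @lebesgue_rV R d, forall y, P y} -> {ae @lebesgue_rV R d, forall y, Q y}.
Proof. exact: (@filterS _ _ (ae_filter_ringOfSetsType (@lebesgue_rV R d))). Qed.

Lemma ae_lebesgueI (P Q : V -> Prop) : {ae @lebesgue_rV R d, forall y, P y} ->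
  {ae @lebesgue_rV R d, forall y, Q y} ->
  {ae @lebesgue_rV R d, forall y, P y /\ Q y}.
Proof. exact: (@filterI _ _ (ae_filter_ringOfSetsType (@lebesgue_rV R d))). Qed.

Definition lebesgue_ae_eq (U : Type) (q q' : V -> U) : Prop :=
  {ae @lebesgue_rV R d, forall y, q y = q' y}.

Lemma lint_ae q q' : lmeas q -> lmeas q' -> (forall y, 0 <= q y) ->
  (forall y, 0 <= q' y) -> lebesgue_ae_eq q q' -> lebesgue_int q = lebesgue_int q'.
Proof.
move=> mq mq' q0 q'0 qq'; apply: ge0_ae_eq_integral => //.
by apply: ae_lebesgueS qq' => y.
Qed.

Lemma lebesgue_ae_eq_refl (U : Type) (q q' : V -> U) x :
  lebesgue_ae_eq q q' ->
  lebesgue_ae_eq (fun y => q (x - y)%R) (fun y => q' (x - y)%R).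
Proof.
move=> [N [mN N0 qN]].
have P := completed_preserving (measurable_refl x) (measurable_refl x)
  (reflK x) (reflK x) (borel_lebesgue_refl x).
exists ((fun y => x - y)%R @^-1` N); split.
- have := @measurable_preserving _ _ _ _ _ _ (measurable_refl x)
    (measurable_refl x) (reflK x) (reflK x) (borel_lebesgue_refl x) measurableT N mN.
  by rewrite setTI.
- by rewrite /lebesgue_rV P.
- by move=> y /= qy; apply: qN.
Qed.

Lemma lmeas_conv_integrand q1 q2 x : lmeas q1 -> lmeas q2 ->
  lmeas (fun y => q1 (x - y)%R * q2 y).
Proof. by move=> m1 m2; exact: (emeasurable_funM (lmeas_refl x m1) m2). Qed.

(** Each value of a convolution is an integral, so the equality holds at every point although the
    factors agree almost everywhere only. This licenses Borel versions and finite parts in pointwise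
    statements. *)
Lemma conv_ae q1 q2 q1' q2' : lmeas q1 -> lmeas q2 -> lmeas q1' -> lmeas q2' ->
  (forall y, 0 <= q1 y) -> (forall y, 0 <= q2 y) ->
  (forall y, 0 <= q1' y) -> (forall y, 0 <= q2' y) ->
  lebesgue_ae_eq q1 q1' -> lebesgue_ae_eq q2 q2' -> conv q1 q2 = conv q1' q2'.
Proof.
move=> m1 m2 m1' m2' p1 p2 p1' p2' e1 e2; apply/funext => x.
apply: lint_ae; try exact: lmeas_conv_integrand.
- by move=> y; rewrite mule_ge0.
- by move=> y; rewrite mule_ge0.
- by apply: ae_lebesgueS (ae_lebesgueI (lebesgue_ae_eq_refl x e1) e2) => y [-> ->].
Qed.

Lemma borel_version q : lmeas q -> (forall y, 0 <= q y) ->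
  exists q', [/\ measurable_fun setT q', forall y, 0 <= q' y & lebesgue_ae_eq q q'].
Proof.
move=> mq q0; have [|q' [N [mq' q'0 mN N0 qq']]] := completed_fun_version _ mq q0.
  exact: sigma_finiteT.
exists q'; split => //; exists N; split.
- exact: measurable_completed.
- by rewrite /lebesgue_rV completedE.
- by move=> y /= qy; apply: contrapT => /qq'.
Qed.

Lemma lint_fin_ae q : lmeas q -> (forall y, 0 <= q y) ->
  lebesgue_int q < +oo -> lebesgue_ae_eq q (fun y => (fine (q y))%:E).
Proof.
move=> mq q0 qoo.
have : {ae @lebesgue_rV R d, forall y, setT y -> q y \is a fin_num}.
  apply: integrable_ae => //; apply/integrableP; split => //.
  by under eq_integral => y _ do rewrite gee0_abs//.
by apply: ae_lebesgueS => y /(_ I)/fineK.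
Qed.

Section convolution.
Variables q1 q2 : V -> \bar R.
Hypotheses (m1 : lmeas q1) (m2 : lmeas q2).
Hypotheses (p1 : forall y, 0 <= q1 y) (p2 : forall y, 0 <= q2 y).

Lemma conv_ge0 x : 0 <= conv q1 q2 x.
Proof. by apply: lint_ge0 => y; rewrite mule_ge0. Qed.

(** With Borel versions of the factors the integrand is Borel on the product space, and Tonelli's
    theorem applies; the convolution is thus Borel even if its factors are not. *)
Lemma measurable_conv : measurable_fun setT (conv q1 q2).
Proof.
have [b1 [mb1 b10 e1]] := borel_version m1 p1.
have [b2 [mb2 b20 e2]] := borel_version m2 p2.
have lb1 := lmeas_borel mb1; have lb2 := lmeas_borel mb2.
rewrite (conv_ae m1 m2 lb1 lb2)//.
pose u (p : V * V) := b1 (p.1 - p.2)%R * b2 p.2.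
have mu_ : measurable_fun setT u.
  apply: emeasurable_funM.
    apply: (measurableT_comp mb1).
    by apply: measurable_fun_subrV; [exact: measurable_fst|exact: measurable_snd].
  by apply: (measurableT_comp mb2); exact: measurable_snd.
have u0 p : 0 <= u p by rewrite mule_ge0.
rewrite (_ : conv b1 b2 = fun x => \int[borel_lebesgue d]_y u (x, y)).
  exact: (@measurable_fun_fubini_tonelli_F _ _ _ _ R (borel_lebesgue d) u mu_ u0).
apply/funext => x; apply: lint_borel => [|y]; last by rewrite mule_ge0.
apply: emeasurable_funM => //.
exact: (measurableT_comp mb1 (measurable_refl x)).
Qed.

Lemma lmeas_conv : lmeas (conv q1 q2).
Proof. exact: lmeas_borel measurable_conv. Qed.

(** Since [e x = e (x - y) * e y], the weight distributes over the two factors, and Tonelli's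
    theorem with a translation separates the integrals. *)
Lemma exp_moment_conv theta (gamma : R) : exp_moment theta gamma (conv q1 q2) =
  exp_moment theta gamma q1 * exp_moment theta gamma q2.
Proof.
pose e y : \bar R := (expR (gamma * dot theta y))%:E.
have me : measurable_fun setT e.
  apply/measurable_EFinP/measurableT_comp => //.
  by apply: measurable_funM => //; exact: measurable_dotl.
have le := lmeas_borel me.
have e0 y : 0 <= e y by rewrite lee_fin expR_ge0.
have [b1 [mb1 b10 e1]] := borel_version m1 p1.
have [b2 [mb2 b20 e2]] := borel_version m2 p2.
have lb1 := lmeas_borel mb1; have lb2 := lmeas_borel mb2.
have eb q b : lmeas q -> (forall y, 0 <= q y) -> measurable_fun setT b ->
    (forall y, 0 <= b y) -> lebesgue_ae_eq q b ->
    exp_moment theta gamma q = \int[borel_lebesgue d]_y (e y * b y).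
  move=> mq q0 mb b0 qb; rewrite -lint_borel.
  - apply: lint_ae.
    + exact: emeasurable_funM.
    + exact: (emeasurable_funM le (lmeas_borel mb)).
    + by move=> y; rewrite mule_ge0.
    + by move=> y; rewrite mule_ge0.
    + by apply: ae_lebesgueS qb => y ->.
  - exact: emeasurable_funM.
  - by move=> y; rewrite mule_ge0.
rewrite (eb _ _ m1 p1 mb1 b10 e1) (eb _ _ m2 p2 mb2 b20 e2).
rewrite (eb _ _ lmeas_conv conv_ge0 measurable_conv conv_ge0 (aeW _ _))//.
rewrite (conv_ae m1 m2 lb1 lb2)//.
pose u (p : V * V) := e p.1 * (b1 (p.1 - p.2)%R * b2 p.2).
have mdiff : measurable_fun setT (fun p : V * V => p.1 - p.2)%R.
  by apply: measurable_fun_subrV; [exact: measurable_fst|exact: measurable_snd].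
have mu_ : measurable_fun setT u.
  apply: emeasurable_funM.
    by apply: (measurableT_comp me); exact: measurable_fst.
  apply: emeasurable_funM; first exact: (measurableT_comp mb1).
  by apply: (measurableT_comp mb2); exact: measurable_snd.
have u0 p : 0 <= u p by rewrite !mule_ge0.
transitivity (\int[borel_lebesgue d]_x \int[borel_lebesgue d]_y u (x, y)).
  apply: eq_integral => x _; rewrite /u/= ge0_integralZl//; last first.
  - by move=> y _; rewrite mule_ge0.
  - apply: emeasurable_funM => //.
    exact: (measurableT_comp mb1 (measurable_refl x)).
  congr (_ * _); apply: lint_borel => [|y]; last by rewrite mule_ge0.
  apply: emeasurable_funM => //.
  exact: (measurableT_comp mb1 (measurable_refl x)).
rewrite (@fubini_tonelli _ _ _ _ R (borel_lebesgue d) (borel_lebesgue d) u mu_ u0).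
rewrite -ge0_integralZl//; last first.
- by apply: integral_ge0 => y _; rewrite mule_ge0.
- by move=> y _; rewrite mule_ge0.
- exact: emeasurable_funM.
apply: eq_integral => y _; rewrite /u/=.
transitivity (\int[borel_lebesgue d]_x
    ((e (x - y)%R * b1 (x - y)%R) * (e y * b2 y))).
  apply: eq_integral => x _; rewrite !muleA; congr (_ * _).
  rewrite [RHS]muleAC; congr (_ * _).
  rewrite /e -EFinM -expRD -mulrDr -dotDr; congr (expR (gamma * dot theta _))%:E.
  by rewrite subrK.
have me1 : measurable_fun setT (fun x => e x * b1 x) by exact: emeasurable_funM.
have me10 x : 0 <= e x * b1 x by rewrite mule_ge0.
have me1y : measurable_fun setT (fun x => e (x - y)%R * b1 (x - y)%R).
  by apply: (measurableT_comp me1); apply: measurable_fun_subrV.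
have eb0 : 0 <= e y * b2 y by rewrite mule_ge0.
transitivity ((\int[borel_lebesgue d]_x (e (x - y)%R * b1 (x - y)%R)) *
    (e y * b2 y)).
  exact: (ge0_integralZr _ measurableT me1y (fun x _ => me10 (x - y)%R) eb0).
have -> : \int[borel_lebesgue d]_x (e (x - y)%R * b1 (x - y)%R) =
    \int[borel_lebesgue d]_x (e x * b1 x).
  rewrite -(lint_borel me1y (fun x => me10 _)) -(lint_borel me1 me10).
  exact: (@lint_shift (fun x => e x * b1 x) y (lmeas_borel me1) me10).
by [].
Qed.

End convolution.

Lemma exp_moment0 theta q : exp_moment theta 0 q = lebesgue_int q.
Proof.
by congr lebesgue_int; apply/funext => y; rewrite mul0r expR0 mul1e.
Qed.

Lemma lmeas_expdot theta (gamma : R) :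
  lmeas (fun y => (expR (gamma * dot theta y))%:E : \bar R).
Proof.
apply/lmeas_borel/measurable_EFinP/measurableT_comp => //.
by apply: measurable_funM => //; exact: measurable_dotl.
Qed.

End lebesgue_functions.

(** * Limits in the extended reals, Fatou and Pratt *)

Section limit_tools.
Context {R : realType}.
Local Open Scope ereal_scope.

Lemma cvge_between {T : Type} (F : set_system T) {FF : Filter F}
    (A : T -> \bar R) (a : R) :
  (forall e : R, (0 < e)%R -> \forall x \near F, (a - e)%:E <= A x) ->
  (forall e : R, (0 < e)%R -> \forall x \near F, A x <= (a + e)%:E) ->
  A @ F --> a%:E.
Proof.
move=> lo up; apply/fine_cvgP; split.
  near=> x; rewrite fin_numElt.
  rewrite (lt_le_trans _ (_ : (a - 1)%:E <= A x)) ?ltNyr//=; last first.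
    by near: x; exact: lo.
  rewrite (le_lt_trans (_ : A x <= (a + 1)%:E)) ?ltry//.
  by near: x; exact: up.
apply/cvgrPdist_le => e e0; near=> x.
have : (a - e)%:E <= A x by near: x; exact: lo.
have : A x <= (a + e)%:E by near: x; exact: up.
rewrite /=; case: (A x) => [r| |]//=; rewrite !lee_fin ler_norml => ? ?.
by apply/andP; split; lra.
Unshelve. all: by end_near. Qed.

Lemma cvge_eps {T : Type} (F : set_system T) {FF : Filter F}
    (A : T -> \bar R) (a : R) : A @ F --> a%:E ->
  forall e : R, (0 < e)%R ->
  \forall x \near F, (a - e)%:E <= A x /\ A x <= (a + e)%:E.
Proof.
move=> /fine_cvgP[Afin /cvgrPdist_le Aa] e e0; near=> x.
have : (`|a - fine (A x)| <= e)%R by near: x; exact: Aa.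
have : A x \is a fin_num by near: x; exact: Afin.
by case: (A x) => [r| |]//= _; rewrite !lee_fin ler_norml => /andP[? ?]; split; lra.
Unshelve. all: by end_near. Qed.

(** An upper bound of [A + B] and a lower bound of [B] bound [A] from above: if two asymptotic lower
    bounds add up to the limit of the sum, each is a limit. *)
Lemma sandwich {T : Type} (F : set_system T) {FF : Filter F}
    (A B : T -> \bar R) (a b : R) :
  (forall x, 0 <= B x) ->
  (forall e : R, (0 < e)%R -> \forall x \near F, (a - e)%:E <= A x) ->
  (forall e : R, (0 < e)%R -> \forall x \near F, (b - e)%:E <= B x) ->
  (fun x => A x + B x) @ F --> (a + b)%:E -> A @ F --> a%:E.
Proof.
move=> B0 loA loB AB; apply: cvge_between => // e e0.
have e20 : (0 < e / 2)%R by rewrite divr_gt0.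
near=> x.
have : (a - e)%:E <= A x by near: x; exact: loA.
have : (b - e / 2)%:E <= B x by near: x; exact: loB.
have : A x + B x <= (a + b + e / 2)%:E.
  by near: x; apply: filterS (cvge_eps AB e20) => x [].
move: (B0 x).
by case: (A x) => [r| |]; case: (B x) => [s| |]//=; rewrite ?leey//;
  rewrite -?EFinD !lee_fin; lra.
Unshelve. all: by end_near. Qed.

Lemma limn_einf_lower (A : (\bar R)^nat) (a : R) : a%:E <= limn_einf A ->
  forall e : R, (0 < e)%R -> \forall n \near \oo, (a - e)%:E <= A n.
Proof.
move=> aA e e0; have aeA : (a - e)%:E < limn_einf A.
  by apply: lt_le_trans aA; rewrite lte_fin ltrBlDr ltrDl.
move: aeA; rewrite limn_einf_lim.
rewrite (cvg_lim _ (ereal_nondecreasing_cvgn (nondecreasing_einfs A)))//.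
move=> /ereal_sup_gt[_ [n _ <-] aen]; exists n => // m /= nm.
apply: (le_trans (ltW aen)); apply: ereal_inf_lbound.
by exists m.
Qed.

Lemma fatou_lower d (T : measurableType d) (mu : {measure set T -> \bar R})
    (u : nat -> T -> R) (l : T -> R) (a : R) :
  (forall n, measurable_fun setT (u n)) -> (forall n x, (0 <= u n x)%R) ->
  (forall x, u ^~ x @ \oo --> l x) -> \int[mu]_x (l x)%:E = a%:E ->
  forall e : R, (0 < e)%R ->
  \forall n \near \oo, (a - e)%:E <= \int[mu]_x (u n x)%:E.
Proof.
move=> m_u u0 ul la; apply: limn_einf_lower.
have := @fatou _ _ R mu setT measurableT (fun n x => (u n x)%:E).
rewrite (eq_integral (fun x => (l x)%:E)) ?la.
  apply => n; first exact/measurable_EFinP.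
  by move=> x _; rewrite lee_fin.
move=> x _; rewrite is_cvg_limn_einfE.
  by apply/cvg_lim => //; apply: cvg_EFin (ul x); exact: nearW.
by apply: cvgP; apply: cvg_EFin (ul x); exact: nearW.
Qed.

(* Pratt's generalised dominated convergence: Fatou applied to [u] and to
   [v - u]. *)
Lemma pratt d (T : measurableType d) (mu : {measure set T -> \bar R})
    (u v : nat -> T -> R) (lu lv : T -> R) :
  (forall n, measurable_fun setT (u n)) ->
  (forall n, measurable_fun setT (v n)) ->
  measurable_fun setT lu -> measurable_fun setT lv ->
  (forall n x, (0 <= u n x)%R) ->
  (\forall n \near \oo, forall x, (u n x <= v n x)%R) ->
  (forall x, u ^~ x @ \oo --> lu x) -> (forall x, v ^~ x @ \oo --> lv x) ->
  \int[mu]_x (lv x)%:E < +oo ->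
  \int[mu]_x (v n x)%:E @[n --> \oo] --> \int[mu]_x (lv x)%:E ->
  \int[mu]_x (u n x)%:E @[n --> \oo] --> \int[mu]_x (lu x)%:E.
Proof.
move=> m_u m_v m_lu m_lv u0 [N _ uv] ulu vlv lvoo vcv.
have lu0 x : (0 <= lu x)%R.
  by apply: (ler_cvg_to (cvg_cst 0%R) (ulu x)); exact: nearW.
have luv x : (lu x <= lv x)%R.
  by apply: (ler_cvg_to (ulu x) (vlv x)); exists N => // n Nn; exact: uv.
have ilu : \int[mu]_x (lv x)%:E =
    \int[mu]_x (lu x)%:E + \int[mu]_x (lv x - lu x)%:E.
  rewrite -ge0_integralD//.
  - by apply: eq_integral => x _; rewrite -EFinD addrC subrK.
  - by move=> x _; rewrite lee_fin.
  - exact/measurable_EFinP.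
  - by move=> x _; rewrite lee_fin subr_ge0.
  - by apply/measurable_EFinP; exact: measurable_funB.
have a0 : 0 <= \int[mu]_x (lu x)%:E.
  by apply: integral_ge0 => x _; rewrite lee_fin.
have b0 : 0 <= \int[mu]_x (lv x - lu x)%:E.
  by apply: integral_ge0 => x _; rewrite lee_fin subr_ge0.
have [a aE] : exists a : R, \int[mu]_x (lu x)%:E = a%:E.
  exists (fine (\int[mu]_x (lu x)%:E)); rewrite fineK// ge0_fin_numE//.
  by apply: le_lt_trans lvoo; rewrite ilu leeDl.
have [b bE] : exists b : R, \int[mu]_x (lv x - lu x)%:E = b%:E.
  exists (fine (\int[mu]_x (lv x - lu x)%:E)); rewrite fineK// ge0_fin_numE//.
  by apply: le_lt_trans lvoo; rewrite ilu leeDr.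
(* The domination holds from [N] on only; after the shift [v - u] is non-negative throughout, as
   Fatou's lemma requires. *)
rewrite aE -(cvg_shiftn N).
apply: (@sandwich _ \oo _ _
    (fun n => \int[mu]_x (v (n + N)%N x - u (n + N)%N x)%:E) a b).
- move=> n; apply: integral_ge0 => x _; rewrite lee_fin subr_ge0 uv//=.
  exact: leq_addl.
- apply: (fatou_lower (l := lu)) => //.
  by move=> x; have := ulu x; rewrite -(cvg_shiftn N).
- apply: (fatou_lower (l := fun x => lv x - lu x)%R) => //.
  + by move=> n; exact: measurable_funB.
  + by move=> n x; rewrite subr_ge0 uv//= leq_addl.
  + move=> x; apply: cvgB.
      by have := vlv x; rewrite -(cvg_shiftn N).
    by have := ulu x; rewrite -(cvg_shiftn N).
- move: vcv; rewrite ilu aE bE -(cvg_shiftn N); apply: cvg_trans.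
  apply: near_eq_cvg; near=> n.
  rewrite -ge0_integralD//.
  + by apply: eq_integral => x _; rewrite -EFinD addrC subrK.
  + by move=> x _; rewrite lee_fin.
  + exact/measurable_EFinP.
  + by move=> x _; rewrite lee_fin subr_ge0 uv//= leq_addl.
  + by apply/measurable_EFinP; exact: measurable_funB.
Unshelve. all: by end_near. Qed.

End limit_tools.

(** * Convolutions split at a hyperplane orthogonal to the ray *)

Section half_spaces.
Context {R : realType} {d : nat}.
Local Notation V := 'rV[R]_d.
Variables (theta : V) (gamma : R).
Hypothesis theta1 : enorm theta = 1.
Implicit Types (b : bool) (t : R) (psi phi q w : V -> R) (N : R -> R).

(* [half true t] and [half false t] are the closed and the open half space
   below [t / 2]: the reflection [y |-> t *: theta - y] maps each onto the
   complement of the other. *)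
Definition half b t y : bool := dot theta y < t / 2 ?<= if b.

(** The two factors play different roles: on the half space [psi] is evaluated far out, and supplies
    the limit, while [phi] stays in place and supplies the moment. *)
Definition half_fun b t psi phi y : R :=
  if half b t y then psi (t *: theta - y) * phi y else 0.

Definition half_int b t psi phi : \bar R :=
  lebesgue_int (EFin \o half_fun b t psi phi).

Lemma dot_ray t y : dot theta (t *: theta - y) = t - dot theta y.
Proof. by rewrite dotBr dotZr -sqr_enorm theta1 expr1n mulr1. Qed.

Lemma half_refl t y : half false t (t *: theta - y) = ~~ half true t y.
Proof. by rewrite /half /= dot_ray -ltNge; apply/idP/idP; lra. Qed.

Lemma half_near b y : \forall t \near +oo, half b t y.
Proof.
near=> t; have : dot theta y < t / 2.
  by rewrite ltr_pdivlMr//; near: t; apply: nbhs_pinfty_gt; rewrite num_real.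
by rewrite /half; case: b => //= /ltW.
Unshelve. all: by end_near. Qed.

(** By Cauchy-Schwarz against the unit vector, the norm is at least [t - dot theta y]. *)
Lemma half_enorm b t y : half b t y -> t / 2 <= enorm (t *: theta - y).
Proof.
move=> hy; have ty : dot theta y <= t / 2.
  by move: hy; rewrite /half; case: b => //= /ltW.
have := dot_le theta (t *: theta - y); rewrite dot_ray theta1 mul1r.
by apply: le_trans; lra.
Qed.

Lemma measurable_half b t : measurable_fun setT (half b t).
Proof.
have mdot := @measurable_dotl R d theta.
by rewrite /half; case: b => /=; [apply: measurable_fun_ler|
  apply: measurable_fun_ltr].
Qed.

Lemma lmeas_half_fun b t psi phi : lmeas psi -> lmeas phi ->
  lmeas (half_fun b t psi phi).
Proof.
move=> mpsi mphi; apply: measurable_fun_ifT.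
- exact: (lmeas_borel (measurable_half b t)).
- exact: (measurable_funM (lmeas_refl (t *: theta) mpsi) mphi).
- exact: (@measurable_cst _ _ _ _ _ (0 : R)).
Qed.

Lemma half_fun_ge0 b t psi phi y : (forall y, 0 <= psi y) ->
  (forall y, 0 <= phi y) -> 0 <= half_fun b t psi phi y.
Proof. by move=> p0 q0; rewrite /half_fun; case: ifP => // _; rewrite mulr_ge0. Qed.

Lemma half_int_ge0 b t psi phi : (forall y, 0 <= psi y) ->
  (forall y, 0 <= phi y) -> (0 <= half_int b t psi phi)%E.
Proof. by move=> p0 q0; apply: lint_ge0 => y; rewrite lee_fin half_fun_ge0. Qed.

Lemma lmeasZ (c : R) phi : lmeas phi -> lmeas (fun y => c * phi y).
Proof.
by move=> mphi; exact: (measurable_funM (@measurable_cst _ _ _ _ _ c) mphi).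
Qed.

Lemma half_intZ b t psi phi (c : R) : lmeas psi -> lmeas phi ->
  (forall y, 0 <= psi y) -> (forall y, 0 <= phi y) -> 0 <= c ->
  (half_int b t psi phi * c%:E)%E =
  lebesgue_int (fun y => (half_fun b t psi phi y * c)%:E).
Proof.
move=> mpsi mphi psi0 phi0 c0; rewrite muleC /half_int -lintZl.
- by congr lebesgue_int; apply/funext => y; rewrite /= -EFinM mulrC.
- by apply/measurable_EFinP; exact: lmeas_half_fun.
- by move=> y; rewrite lee_fin half_fun_ge0.
- by rewrite lee_fin.
Qed.

(** Reflecting the upper part by [t *: theta - y] brings it to the lower half space and exchanges
    the factors; taking one half space closed and the other open counts the hyperplane once. The
    shift [z] is absorbed into [q1]. *)
Lemma conv_half q1 q2 t (z : V) : lmeas q1 -> lmeas q2 -> (forall y, 0 <= q1 y) ->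
  (forall y, 0 <= q2 y) ->
  conv (EFin \o q1) (EFin \o q2) (t *: theta - z) =
  (half_int true t (fun y => q1 (y - z)%R) q2 +
   half_int false t q2 (fun y => q1 (y - z)%R))%E.
Proof.
move=> m1 m2 p1 p2; have m1z := lmeas_shift z m1.
have mf := lmeas_half_fun false t m2 m1z.
rewrite /half_int -[X in (_ + X)%E](@lint_refl _ _ _ (t *: theta)); last first.
- by move=> y; rewrite lee_fin half_fun_ge0.
- exact/measurable_EFinP.
rewrite -lintD; last first.
- by move=> y; rewrite lee_fin half_fun_ge0.
- by move=> y; rewrite lee_fin half_fun_ge0.
- by apply: (@lmeas_refl _ _ _ _ (EFin \o _)); exact/measurable_EFinP.
- by apply/measurable_EFinP; exact: lmeas_half_fun.
congr lebesgue_int; apply/funext => y; rewrite /= -!EFinM -EFinD /half_fun.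
rewrite half_refl; case: ifP => _ /=.
  by rewrite addr0; congr (q1 _ * q2 y)%:E; rewrite addrAC.
rewrite add0r (reflK (t *: theta) y) mulrC.
by congr (q2 y * q1 _)%:E; rewrite addrAC.
Qed.

(** The normaliser [N] is separate from [psi], so that functions other than [f] can be measured
    against [f]; [a] is then their ratio along the ray. *)
Definition ray_limit psi N (a : R) : Prop := forall y,
  psi (t *: theta - y) / N t @[t --> +oo] --> a * expR (gamma * dot theta y).

Lemma half_fun_cvg b psi phi N a (u : nat -> R) y : ray_limit psi N a ->
  u n @[n --> \oo] --> +oo ->
  half_fun b (u n) psi phi y / N (u n) @[n --> \oo] -->
  a * (expR (gamma * dot theta y) * phi y).
Proof.
move=> lim uoo; rewrite mulrA.
have : psi (u n *: theta - y) / N (u n) * phi y @[n --> \oo] -->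
    a * expR (gamma * dot theta y) * phi y.
  by apply: cvgMl; exact: (cvg_comp _ _ uoo (lim y)).
apply: cvg_trans; apply: near_eq_cvg; near=> n.
rewrite /half_fun ifT; first by rewrite mulrAC.
by near: n; exact: (uoo _ (half_near b y)).
Unshelve. all: by end_near. Qed.

Let e y := expR (gamma * dot theta y).

Let me : lmeas e.
Proof. by have := lmeas_expdot theta gamma; move/measurable_EFinP. Qed.

Lemma lint_exp_moment phi (a k : R) : lmeas phi -> (forall y, 0 <= phi y) ->
  0 <= a -> exp_moment theta gamma (EFin \o phi) = k%:E ->
  lebesgue_int (fun y => (a * (expR (gamma * dot theta y) * phi y))%:E) =
  (a * k)%:E.
Proof.
move=> mphi phi0 a0 phik; rewrite EFinM -phik -lintZl ?lee_fin//.
- apply: emeasurable_funM; first exact: lmeas_expdot.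
  exact/measurable_EFinP.
- by move=> y; rewrite -EFinM lee_fin mulr_ge0// expR_ge0.
Qed.

(** Every fixed [y] lies in the half space for large [t], so the normalised integrand converges
    pointwise on the whole space and Fatou's lemma applies. *)
Lemma half_int_lower b psi phi N a k : lmeas psi -> lmeas phi ->
  (forall y, 0 <= psi y) -> (forall y, 0 <= phi y) -> (forall t, 0 <= N t) ->
  0 <= a -> ray_limit psi N a ->
  exp_moment theta gamma (EFin \o phi) = k%:E ->
  forall u : nat -> R, u n @[n --> \oo] --> +oo ->
  forall eps : R, 0 < eps -> \forall n \near \oo,
    ((a * k - eps)%:E <= half_int b (u n) psi phi * (N (u n))^-1%:E)%E.
Proof.
move=> mpsi mphi psi0 phi0 N0 a0 lim phik u uoo.
have lint_lim := lint_exp_moment mphi phi0 a0 phik.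
have := @fatou_lower R _ _ (@lebesgue_rV R d)
  (fun n y => half_fun b (u n) psi phi y / N (u n))
  (fun y => a * (expR (gamma * dot theta y) * phi y)) (a * k) _ _ _ lint_lim.
move=> fat eps eps0; have [| | |M _ MP] := fat _ _ _ _ eps0.
- move=> n; apply: measurable_funM; first exact: lmeas_half_fun.
  exact: measurable_cst.
- by move=> n y; rewrite mulr_ge0 ?half_fun_ge0// invr_ge0.
- by move=> y; exact: half_fun_cvg.
- exists M => // n Mn; have := MP n Mn.
  by rewrite half_intZ// invr_ge0.
Qed.

(* The class [subexp_class] for a real-valued function, apart from the
   integrability of [q]. *)
Record tail_class q (h : R) : Prop := {
  tail_meas : lmeas q ;
  tail_ge0 : forall y, 0 <= q y ;
  tail_gt0 : \forall t \near +oo, 0 < q (t *: theta) ;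
  tail_shift : ray_limit q (fun t => q (t *: theta)) 1 ;
  tail_moment : exp_moment theta gamma (EFin \o q) = h%:E ;
  tail_conv : (conv (EFin \o q) (EFin \o q) (t *: theta) *
    (q (t *: theta))^-1%:E)%E @[t --> +oo] --> (h + h)%:E }.

(** Both halves have asymptotic lower bound [h] by Fatou's lemma, and their sum tends to [h + h], so
    neither can exceed [h] in the limit. *)
Lemma half_int_tail b q h : tail_class q h ->
  (half_int b t q q * (q (t *: theta))^-1%:E)%E @[t --> +oo] --> h%:E.
Proof.
case=> mq q0 _ lim qh qconv; apply/cvge_pinftyP => u uoo.
have lower c := half_int_lower c mq mq q0 q0 (fun t => q0 (t *: theta))
  ler01 lim qh uoo.
have pos c n : (0 <= half_int c (u n) q q * (q (u n *: theta))^-1%:E)%E.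
  by rewrite mule_ge0 ?half_int_ge0// lee_fin invr_ge0.
apply: (@sandwich _ _ \oo _ _
  (fun n => half_int (~~ b) (u n) q q * (q (u n *: theta))^-1%:E)%E h h).
- by move=> n; exact: pos.
- by move=> eps /(lower b); rewrite mul1r.
- by move=> eps /(lower (~~ b)); rewrite mul1r.
- move/cvge_pinftyP : qconv => /(_ u uoo); apply: cvg_trans.
  apply: near_eq_cvg; apply: nearW => n.
  rewrite -ge0_muleDl ?half_int_ge0//; congr (_ * _)%E.
  rewrite -[in LHS](subr0 (u n *: theta)) conv_half//.
  have -> : (fun y => q (y - 0)) = q by apply/funext => y; rewrite subr0.
  by case: b => //=; rewrite addeC.
Qed.

(** Pratt's lemma. The majorant moves with [t] and is not bounded by one integrable function, but
    its integrals converge by [half_int_tail]; [w] takes up what is dominated in the ordinary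
    sense. *)
Lemma half_int_dominated b q h psi phi w N a k (C : R) : tail_class q h ->
  lmeas psi -> lmeas phi -> lmeas w ->
  (forall y, 0 <= psi y) -> (forall y, 0 <= phi y) -> (forall y, 0 <= w y) ->
  (forall t, 0 <= N t) -> 0 <= a -> ray_limit psi N a ->
  exp_moment theta gamma (EFin \o phi) = k%:E ->
  (lebesgue_int (EFin \o w) < +oo)%E -> 0 <= C ->
  (\forall t \near +oo, forall y, half b t y ->
    psi (t *: theta - y) * phi y / N t <=
    C * (q (t *: theta - y) * q y / q (t *: theta)) + w y) ->
  (half_int b t psi phi * (N t)^-1%:E)%E @[t --> +oo] --> (a * k)%:E.
Proof.
move=> qh mpsi mphi mw psi0 phi0 w0 N0 a0 lim phik woo C0 dom.
have [mq q0 _ qlim qmom _] := qh.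
apply/cvge_pinftyP => u uoo.
pose qi n := (q (u n *: theta))^-1.
have qi0 n : 0 <= qi n by rewrite invr_ge0.
pose U n y := half_fun b (u n) psi phi y / N (u n).
pose W n y := C * (half_fun b (u n) q q y * qi n) + w y.
pose lU y := a * (expR (gamma * dot theta y) * phi y).
pose lW y := C * (1 * (expR (gamma * dot theta y) * q y)) + w y.
have mqq n : lmeas (fun y => half_fun b (u n) q q y * qi n).
  apply: (measurable_funM (lmeas_half_fun b (u n) mq mq)).
  exact: measurable_cst.
have qq0 n y : 0 <= half_fun b (u n) q q y * qi n.
  by rewrite mulr_ge0// half_fun_ge0.
have intW n : lebesgue_int (EFin \o W n) = (C%:E *
    (half_int b (u n) q q * (qi n)%:E) + lebesgue_int (EFin \o w))%E.
  rewrite half_intZ// -lintZl ?lee_fin//; first last.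
  - by move=> y; rewrite lee_fin.
  - exact/measurable_EFinP/(mqq n).
  rewrite -lintD//.
  - apply: emeasurable_funM; first exact: measurable_cst.
    exact/measurable_EFinP/(mqq n).
  - exact/measurable_EFinP.
  - by move=> y; rewrite -EFinM lee_fin mulr_ge0.
have meq : lmeas (fun y => 1 * (expR (gamma * dot theta y) * q y)).
  exact: (lmeasZ 1 (measurable_funM me mq)).
have eq0 y : 0 <= 1 * (expR (gamma * dot theta y) * q y).
  by rewrite mul1r mulr_ge0// expR_ge0.
have intlW : lebesgue_int (EFin \o lW) =
    ((C * h)%:E + lebesgue_int (EFin \o w))%E.
  have -> : (C * h)%:E = (C%:E * (1 * h)%:E)%E by rewrite mul1r.
  rewrite -(lint_exp_moment mq q0 ler01 qmom) -lintZl ?lee_fin//; last first.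
  - exact/measurable_EFinP/meq.
  rewrite -lintD//.
  - apply: emeasurable_funM; first exact: measurable_cst.
    exact/measurable_EFinP/meq.
  - exact/measurable_EFinP/mw.
  - by move=> y; rewrite -EFinM lee_fin mulr_ge0.
rewrite -(lint_exp_moment mphi phi0 a0 phik).
have -> : (fun n => half_int b (u n) psi phi * (N (u n))^-1%:E)%E =
    (fun n => lebesgue_int (fun y => (U n y)%:E)).
  by apply/funext => n; rewrite half_intZ// invr_ge0.
apply: (@pratt R _ _ (@lebesgue_rV R d) U W lU lW).
- move=> n; apply: (measurable_funM (lmeas_half_fun b (u n) mpsi mphi)).
  exact: measurable_cst.
- by move=> n; exact: (measurable_funD (lmeasZ C (mqq n)) mw).
- exact: (lmeasZ a (measurable_funM me mphi)).
- exact: (measurable_funD (lmeasZ C meq) mw).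
- by move=> n y; rewrite mulr_ge0 ?half_fun_ge0// invr_ge0.
- have [M _ MP] := uoo _ dom; exists M => // n Mn y; rewrite /U /W /half_fun.
  case: ifP => [/(MP n Mn y)|_]; first exact.
  by rewrite !mul0r mulr0 add0r.
- by move=> y; exact: half_fun_cvg.
- move=> y; apply: cvgD; last exact: cvg_cst.
  have Hy := @half_fun_cvg b q q (fun t => q (t *: theta)) 1 u y qlim uoo.
  by apply: cvgM; [exact: cvg_cst|exact: Hy].
- by rewrite [X in (X < _)%E]intlW lte_add_pinfty// ltry.
- rewrite [X in _ --> X]intlW.
  rewrite (_ : (fun n => _) = fun n => (C%:E * (half_int b (u n) q q * (qi n)%:E)
      + lebesgue_int (EFin \o w))%E); last first.
    by apply/funext => n; exact: intW.
  apply: cvgeD; last exact: cvg_cst.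
    by rewrite fin_num_adde_defr.
  rewrite EFinM; apply: cvgeZl => //.
  by have /cvge_pinftyP := half_int_tail b qh; exact.
Qed.

End half_spaces.

(** * Limits relative to an almost radial function *)

Section almost_radial.
Context {R : realType} {d : nat}.
Local Notation V := 'rV[R]_d.
Variables (f : V -> R) (theta : V) (gamma K : R).
Hypothesis theta1 : enorm theta = 1.
Hypothesis f0 : forall x, 0 <= f x.
Hypothesis fgt0 : forall x, x != 0 -> 0 < f x.
Hypothesis K1 : 1 <= K.
Hypothesis f_decr : forall z w : V,
  w != 0 -> enorm w <= enorm z -> f z <= K * f w.
Hypothesis f_shift : ray_limit theta gamma f (fun t => f (t *: theta)) 1.

Implicit Types (psi phi q : V -> R) (a k h t : R) (b : bool).

Let ray t : V := t *: theta.

Let enorm_ray t : 0 <= t -> enorm (ray t) = t.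
Proof. by move=> t0; rewrite enormZ theta1 mulr1 ger0_norm. Qed.

Let ray_neq0 t : 0 < t -> ray t != 0.
Proof. by move=> t0; rewrite -enorm_gt0 enorm_ray// ltW. Qed.

Let fray t : 0 < t -> 0 < f (ray t).
Proof. by move=> t0; apply/fgt0/ray_neq0. Qed.

Let K0 : 0 < K. Proof. exact: lt_le_trans ltr01 K1. Qed.

(** With [t] the norm of [w], pass from [w - z] to [ray (t - rho)] at the cost of [K], from there to
    [ray t] by the limit at [y = ray rho], and back to [w] at the cost of another [K]. A limit on
    one ray thus bounds shifts in all directions. *)
Lemma shift_bound rho : 0 <= rho -> exists C T : R, [/\ 0 < C, 0 < T &
  forall w z : V, T <= enorm w -> enorm z <= rho -> f (w - z) <= C * f w].
Proof.
move=> rho0; set E := 1 * expR (gamma * dot theta (ray rho)).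
have E0 : 0 < E + 1 by rewrite /E mul1r addr_gt0// expR_gt0.
have /cvgr_lt/(_ (E + 1)) := @f_shift (ray rho).
rewrite ltrDl ltr01 => /(_ isT)[M [_ MP]].
(* Beyond [M + 1] the limit is effective; beyond [rho + 1] the point [ray (t - rho)] is not the
   origin, where [f_decr] gives no bound. *)
exists (K * (E + 1) * K), (Num.max (M + 1) (rho + 1)); split.
- by rewrite !mulr_gt0.
- by rewrite lt_max; apply/orP; right; lra.
move=> w z; rewrite ge_max => /andP[Mw rw] zr; set t := enorm w in Mw rw.
have t0 : 0 < t by lra.
have w0 : w != 0 by rewrite -enorm_gt0.
apply: (@le_trans _ _ (K * f (ray (t - rho)))).
  apply: f_decr; first by apply: ray_neq0; lra.
  rewrite enorm_ray; last lra.
  by apply: le_trans (enorm_sub_ge w z); rewrite lerB.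
rewrite -!mulrA ler_pM2l//.
apply: (@le_trans _ _ ((E + 1) * f (ray t))).
  have /MP : M < t by lra.
  rewrite -/(ray t) ltr_pdivrMr ?fray// => /ltW.
  by apply: le_trans; rewrite /ray scalerBl.
rewrite ler_pM2l//; apply: f_decr => //.
by rewrite enorm_ray// ltW.
Qed.

(** The functions to which the limits of [f] transfer, with ratio [a] to [f] along the ray and
    exponential moment [k]. For a convolution, [conv_ray] computes the ratio, whereas the bound by
    [f] needs a separate argument. *)
Record tame (q : V -> R) (a k : R) : Prop := {
  tame_meas : lmeas q ;
  tame_ge0 : forall y, 0 <= q y ;
  tame_bound : exists C T : R, 0 <= C /\
    forall x, T <= enorm x -> q x <= C * f x ;
  tame_int : (lebesgue_int (EFin \o q) < +oo)%E ;
  tame_coef : 0 <= a ;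
  tame_moment : exp_moment theta gamma (EFin \o q) = k%:E ;
  tame_limit : ray_limit theta gamma q (fun t => f (t *: theta)) a }.

Lemma tame_shift_bound q a k (z : V) : tame q a k -> exists C T : R, 0 <= C /\
  forall x, T <= enorm x -> q (x - z) <= C * f x.
Proof.
case=> _ _ [C [T [C0 qC]]] _ _ _ _.
have [Cz [Tz [Cz0 Tz0 fz]]] := shift_bound (enorm_ge0 z).
exists (C * Cz), (Num.max Tz (T + enorm z)); split.
  by rewrite mulr_ge0// ltW.
move=> x; rewrite ge_max => /andP[xTz xT].
apply: le_trans (qC _ _) _.
  by apply: le_trans (enorm_sub_ge x z); rewrite lerBrDr.
by rewrite -mulrA ler_wpM2l// fz.
Qed.

(** The majorant is chosen according to [y]. In a ball, where [phi] is merely integrable,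
    [psi (t *: theta - y)] is at most a multiple of [f (t *: theta)] by [shift_bound], which gives
    [w]; outside it both factors are bounded by multiples of [f]. *)
Lemma half_int_tame b h psi phi a k : tail_class theta gamma f h ->
  lmeas psi -> lmeas phi -> (forall y, 0 <= psi y) -> (forall y, 0 <= phi y) ->
  (exists C T : R, 0 <= C /\ forall x, T <= enorm x -> psi x <= C * f x) ->
  (exists C T : R, 0 <= C /\ forall x, T <= enorm x -> phi x <= C * f x) ->
  (lebesgue_int (EFin \o phi) < +oo)%E -> 0 <= a ->
  ray_limit theta gamma psi (fun t => f (t *: theta)) a ->
  exp_moment theta gamma (EFin \o phi) = k%:E ->
  (half_int theta b t psi phi * (f (t *: theta))^-1%:E)%E @[t --> +oo] -->
    (a * k)%:E.
Proof.
move=> fh mpsi mphi psi0 phi0 [C1 [T1 [C10 psiC]]] [C2 [T2 [C20 phiC]]] phioo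
  a0 lim phik.
have T20 : 0 <= Num.max T2 0 by rewrite le_max lexx orbT.
have [Cs [Ts [Cs0 Ts0 fs]]] := shift_bound T20.
pose ball (y : V) := enorm y <= Num.max T2 0.
have mball : lmeas ball.
  apply: (lmeas_borel (measurable_fun_ler measurable_enorm _)).
  exact: measurable_cst.
pose w y := C1 * Cs * (if ball y then phi y else 0).
have mif : lmeas (fun y => if ball y then phi y else 0).
  exact: (measurable_fun_ifT mball mphi (@measurable_cst _ _ _ _ _ (0 : R))).
have if0 y : 0 <= (if ball y then phi y else 0) by case: ifP.
have w0 y : 0 <= w y by rewrite !mulr_ge0// ltW.
have mw : lmeas w by exact: lmeasZ.
have woo : (lebesgue_int (EFin \o w) < +oo)%E.
  rewrite (_ : _ \o _ = fun y => (C1 * Cs)%:E *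
      (if ball y then phi y else 0)%:E)%E; last by apply/funext => y.
  have cc : (0 <= (C1 * Cs)%:E)%E by rewrite lee_fin mulr_ge0// ltW.
  rewrite lintZl//; last exact/measurable_EFinP/mif.
  apply: lte_mul_pinfty => //; apply: le_lt_trans phioo.
  apply: le_lint.
  - exact/measurable_EFinP/mif.
  - exact/measurable_EFinP/mphi.
  - by move=> y; rewrite lee_fin.
  - by move=> y /=; rewrite lee_fin; case: ifP.
apply: (@half_int_dominated _ _ _ _ theta1 b f h psi phi w
  (fun t => f (t *: theta)) a k (C1 * C2) fh mpsi mphi mw psi0 phi0 w0
  (fun t => f0 _) a0 lim phik woo (mulr_ge0 C10 C20)).
near=> t => y hy.
have tT : Num.max T1 1 * 2 < t.
  by near: t; apply: nbhs_pinfty_gt; rewrite num_real.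
have tTs : Ts < t by near: t; apply: nbhs_pinfty_gt; rewrite num_real.
have t0 : 0 < t by lra.
have ft : 0 < f (t *: theta) by exact: fray.
have yT : T1 <= enorm (t *: theta - y).
  have T1m : T1 <= Num.max T1 1 by rewrite le_max lexx.
  by apply: (le_trans _ (half_enorm theta1 hy)); lra.
have psiy := psiC _ yT.
have [yb|yb] := boolP (ball y).
  apply: (@le_trans _ _ (w y)); last first.
    by rewrite lerDr !mulr_ge0 ?invr_ge0// ltW.
  rewrite /w yb ler_pdivrMr// mulrAC ler_wpM2r//.
  apply: (le_trans psiy); rewrite -mulrA ler_wpM2l//.
  by apply: fs => //; rewrite enorm_ray// ltW.
rewrite /w (negbTE yb) mulr0 addr0 !mulrA ler_pM2r ?invr_gt0//.
have /phiC phiy : T2 <= enorm y.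
  by move: yb; rewrite /ball -ltNge gt_max => /andP[/ltW].
apply: (@le_trans _ _ ((C1 * f (t *: theta - y)) * (C2 * f y))).
  by apply: ler_pM.
by rewrite mulrACA mulrA.
Unshelve. all: by end_near. Qed.

Lemma exp_moment_shift q (z : V) (k : R) : lmeas q -> (forall y, 0 <= q y) ->
  exp_moment theta gamma (EFin \o q) = k%:E ->
  exp_moment theta gamma (EFin \o (fun y => q (y - z))) =
    (expR (gamma * dot theta z) * k)%:E.
Proof.
move=> mq q0 qk; rewrite EFinM -qk.
have meq : lmeas (fun y => (expR (gamma * dot theta y))%:E * (q y)%:E)%E.
  apply: emeasurable_funM; [exact: lmeas_expdot|exact/measurable_EFinP/mq].
have eq0 y : (0 <= (expR (gamma * dot theta y))%:E * (q y)%:E)%E.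
  by rewrite -EFinM lee_fin mulr_ge0// expR_ge0.
have ez : (0 <= (expR (gamma * dot theta z))%:E)%E by rewrite lee_fin expR_ge0.
have -> : exp_moment theta gamma (EFin \o q) =
  lebesgue_int (fun y => (expR (gamma * dot theta y))%:E * (q y)%:E)%E by [].
rewrite -(lint_shift z meq eq0) -(lintZl (lmeas_shift z meq) _ ez)//.
congr lebesgue_int; apply/funext => y; rewrite /= muleA; congr (_ * _)%E.
by rewrite -EFinM -expRD -mulrDr -dotDr addrC subrK.
Qed.

(** One factor sits far out and contributes its ratio, the other one its moment; the two halves give
    the two choices. The shift by [z] multiplies both ratio and moment of [q1] by the same
    exponential. *)
Lemma conv_ray h q1 q2 a1 a2 k1 k2 (z : V) : tail_class theta gamma f h ->
  tame q1 a1 k1 -> tame q2 a2 k2 ->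
  (conv (EFin \o q1) (EFin \o q2) (t *: theta - z) *
    (f (t *: theta))^-1%:E)%E @[t --> +oo] -->
  ((a1 * k2 + a2 * k1) * expR (gamma * dot theta z))%:E.
Proof.
move=> fh q1t q2t.
have [C1T1 C2T2] := (tame_shift_bound z q1t, tame_bound q2t).
have [m1 p1 _ i1 a10 h1 l1] := q1t; have [m2 p2 _ i2 a20 h2 l2] := q2t.
set E := expR (gamma * dot theta z).
have E0 : 0 <= E by exact: expR_ge0.
have m1z := lmeas_shift z m1.
have p1z y : 0 <= q1 (y - z) by [].
have l1z : ray_limit theta gamma (fun y => q1 (y - z))
    (fun t => f (t *: theta)) (a1 * E).
  move=> y; rewrite -mulrA -expRD -mulrDr -dotDr.
  have := l1 (z + y); apply: cvg_trans; apply: near_eq_cvg; apply: nearW => t.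
  by rewrite opprD addrA addrAC.
have i1z : (lebesgue_int (EFin \o (fun y => q1 (y - z)%R)) < +oo)%E.
  rewrite (_ : lebesgue_int _ = lebesgue_int (EFin \o q1))//.
  apply: (@lint_shift _ _ (EFin \o q1) z); first exact/measurable_EFinP/m1.
  by move=> y; rewrite lee_fin.
have lim1 := @half_int_tame true h _ _ _ _ fh m1z m2 p1z p2 C1T1 C2T2 i2
  (mulr_ge0 a10 E0) l1z h2.
have lim2 := @half_int_tame false h _ _ _ _ fh m2 m1z p2 p1z C2T2 C1T1 i1z
  a20 l2 (exp_moment_shift z m1 p1 h1).
have -> : (a1 * k2 + a2 * k1) * E = a1 * E * k2 + a2 * (E * k1) by ring.
rewrite EFinD.
apply: (cvg_trans _
  (cvgeD (isT : (a1 * E * k2)%:E +? (a2 * (E * k1))%:E)%E lim1 lim2)).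
apply: near_eq_cvg; apply: nearW => t /=.
rewrite (conv_half theta1 t z m1 m2 p1 p2).
have I1 := half_int_ge0 theta true t p1z p2.
have I2 := half_int_ge0 theta false t p2 p1z.
by rewrite (ge0_muleDl _ I1 I2).
Qed.

End almost_radial.

(** * Convolution powers and their moments *)

Section convolution_powers.
Context {R : realType} {d : nat}.
Local Notation V := 'rV[R]_d.
Local Open Scope ereal_scope.
Variable q : V -> \bar R.
Hypotheses (mq : lmeas q) (q0 : forall x, 0 <= q x).

Lemma nconvS n : nconv q n.+2 = conv (nconv q n.+1) q.
Proof. by []. Qed.

Lemma nconv_ge0 n x : 0 <= nconv q n.+1 x.
Proof.
elim: n x => [|n IH] x; first exact: q0.
by rewrite nconvS; exact: conv_ge0.
Qed.

Lemma lmeas_nconv n : lmeas (nconv q n.+1).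
Proof.
elim: n => [|n IH]; first exact: mq.
by rewrite nconvS; apply: lmeas_conv => //; exact: nconv_ge0.
Qed.

Lemma exp_moment_nconv (theta : V) (gamma k : R) :
  exp_moment theta gamma q = k%:E ->
  forall n, exp_moment theta gamma (nconv q n.+1) = (k ^+ n.+1)%:E.
Proof.
move=> qk; elim=> [|n IH]; first by rewrite expr1.
rewrite nconvS (exp_moment_conv (lmeas_nconv n) mq (nconv_ge0 n) q0) IH qk.
by rewrite -EFinM -exprSr.
Qed.

Lemma lint_nconv (m : R) : lebesgue_int q = m%:E ->
  forall n, lebesgue_int (nconv q n.+1) = (m ^+ n.+1)%:E.
Proof.
move=> qm n; rewrite -(exp_moment0 0) (@exp_moment_nconv 0%R 0%R m)//.
by rewrite exp_moment0.
Qed.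

End convolution_powers.

(** * Bounds of convolution powers by the function itself *)

Section almost_radial_bounds.
Context {R : realType} {d : nat}.
Local Notation V := 'rV[R]_d.
Variables (f : V -> R) (theta : V) (gamma K m : R).
Hypothesis d0 : (0 < d)%N.
Hypothesis theta1 : enorm theta = 1.
Hypothesis mf : lmeas f.
Hypothesis f0 : forall x, 0 <= f x.
Hypothesis fgt0 : forall x, x != 0 -> 0 < f x.
Hypothesis K1 : 1 <= K.
Hypothesis f_decr : forall z w : V,
  w != 0 -> enorm w <= enorm z -> f z <= K * f w.
Hypothesis intf : lebesgue_int (EFin \o f) = m%:E.
Hypothesis f_shift : ray_limit theta gamma f (fun t => f (t *: theta)) 1.
Implicit Types (x y z : V) (r t : R).

Local Notation ef := (EFin \o f).
Local Notation fpow n := (nconv (EFin \o f) n.+1).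

Let enorm_ray t : 0 <= t -> enorm (t *: theta) = t.
Proof. by move=> t0; rewrite enormZ theta1 mulr1 ger0_norm. Qed.

Let ray_neq0 t : 0 < t -> t *: theta != 0.
Proof. by move=> t0; rewrite -enorm_gt0 enorm_ray// ltW. Qed.

Let fray t : 0 < t -> 0 < f (t *: theta).
Proof. by move=> t0; apply/fgt0/ray_neq0. Qed.

Let K0 : 0 < K. Proof. exact: lt_le_trans ltr01 K1. Qed.

Let mef : lmeas ef. Proof. exact/measurable_EFinP/mf. Qed.

Let ef0 x : (0 <= ef x)%E. Proof. by rewrite lee_fin. Qed.

Let m0 : 0 <= m.
Proof. by rewrite -lee_fin -intf; exact: lint_ge0. Qed.

Let mpow n : lmeas (fpow n). Proof. exact: lmeas_nconv. Qed.

Let pow0 n x : (0 <= fpow n x)%E. Proof. exact: nconv_ge0. Qed.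

(** Where [f y] is at most [c], the contribution to the convolution is at most [c] times the mass of
    [q]; [u] collects the remaining region. *)
Lemma conv_le_split (q : V -> \bar R) (u : V -> \bar R) (c : R) x :
  lmeas q -> (forall y, 0 <= q y)%E -> lmeas u -> (forall y, 0 <= u y)%E ->
  0 <= c ->
  (forall y, q (x - y)%R * (f y)%:E <= u y + c%:E * q (x - y)%R)%E ->
  (conv q ef x <= lebesgue_int u + c%:E * lebesgue_int q)%E.
Proof.
move=> mq q0 mu u0 c0 le.
have mqx := lmeas_refl x mq.
have c0' : (0 <= c%:E)%E by rewrite lee_fin.
rewrite -(lint_refl x mq q0) -(lintZl mqx (fun y => q0 _) c0').
have mcq : lmeas (fun y => c%:E * q (x - y)%R)%E by exact: measurable_funeM.
have cq0 y : (0 <= c%:E * q (x - y)%R)%E by rewrite mule_ge0.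
rewrite -(lintD mu mcq u0 cq0); apply: le_lint => //.
- exact: lmeas_conv_integrand.
- exact: (emeasurable_funD mu mcq).
- by move=> y; rewrite mule_ge0.
Qed.

(* If [n.+1] summands add up to [x] with [n.+1 * r <= |x|], one of them has
   norm at least [r]. *)
Lemma nconv_pigeonhole n r x : 0 < r -> n.+1%:R * r <= enorm x ->
  (fpow n x <= (n.+1%:R * (K * f (r *: theta)) * m ^+ n)%:E)%E.
Proof.
move=> r0; have Kf0 : 0 <= K * f (r *: theta) by rewrite mulr_ge0// ltW.
have big y : r <= enorm y -> f y <= K * f (r *: theta).
  by move=> ry; apply: f_decr; [exact: ray_neq0|rewrite enorm_ray// ltW].
elim: n x => [|n IH] x nx.
  by rewrite mul1r expr0 mulr1 lee_fin big// -[r]mul1r.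
set B := n.+1%:R * (K * f (r *: theta)) * m ^+ n.
have B0 : 0 <= B by rewrite /B mulr_ge0 ?exprn_ge0// mulr_ge0.
have mBf : lmeas (fun y => B%:E * (f y)%:E)%E by exact: measurable_funeM.
have Bf0 y : (0 <= B%:E * (f y)%:E)%E by rewrite -EFinM lee_fin mulr_ge0.
rewrite nconvS.
apply: le_trans (conv_le_split (mpow n) (pow0 n) mBf Bf0 Kf0 _) _.
  move=> y; have [nxy|nxy] := leP (n.+1%:R * r) (enorm (x - y)).
    apply: (@le_trans _ _ (B%:E * (f y)%:E)%E).
      by apply: lee_wpmul2r; [rewrite lee_fin|exact: IH].
    by rewrite leeDl// mule_ge0.
  apply: (@le_trans _ _ ((K * f (r *: theta))%:E * fpow n (x - y)%R)%E).
    rewrite muleC; apply: lee_wpmul2r => //; rewrite lee_fin; apply: big.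
    have : enorm x <= enorm (x - y) + enorm y by rewrite -{1}(subrK y x) enormD.
    move: nx; rewrite -[n.+2%:R]natr1 mulrDl mul1r => nx xle.
    by move: (le_trans nx xle) nxy; lra.
  by rewrite leeDr.
rewrite (lintZl mef) ?lee_fin// [lebesgue_int ef]intf (lint_nconv mef ef0 intf).
rewrite -!EFinM -EFinD lee_fin /B -[in leRHS]natr1 exprS; lra.
Qed.

(** A cube of side [s = r / (2 d)] with all coordinates in [[s, 2 s]] avoids the origin and lies in
    the ball of radius [r], where [f] is at least [f (r *: theta) / K]. Its mass is at most [m], so
    [f] blows up no faster than [r ^- d] at the origin. *)
Lemma ray_volume_bound r : 0 < r ->
  f (r *: theta) * (r / (2 * d%:R)) ^+ d <= K * m.
Proof.
move=> r0; have d0' : 0 < d%:R :> R by rewrite ltr0n.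
set s := r / (2 * d%:R); have s0 : 0 < s by rewrite divr_gt0// mulr_gt0.
have [|mc muc] := @borel_lebesgue_cube R d s (s + s); first by rewrite lerDl ltW.
have sum_le y : cube d s (s + s) y ->
    f (r *: theta) <= K * f y.
  move=> ycube; have yi i : 0 <= y ord0 i <= s + s.
    by have /andP[sy ->] := ycube i; rewrite (le_trans (ltW s0) sy).
  apply: f_decr.
    apply/eqP => y0; have /andP[+ _] := ycube (Ordinal d0).
    by rewrite y0 mxE leNgt s0.
  rewrite (enorm_ray (ltW r0)); apply: (@le_trans _ _ (d%:R * (s + s))).
    apply: enorm_le_coord => i; have /andP[y1 y2] := yi i.
    by rewrite ger0_norm.
  by rewrite /s le_eqVlt; apply/orP; left; apply/eqP; field; rewrite gt_eqF.
have mind : measurable_fun setT (fun y : V => (\1_(cube d s (s + s)) y : R)).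
  exact: measurable_indic.
rewrite -lee_fin EFinM.
have -> : ((s ^+ d)%:E = lebesgue_int (fun y => (\1_(cube d s (s + s)) y)%:E))%E.
  rewrite lint_borel; last by move=> y; rewrite lee_fin.
    transitivity (borel_lebesgue d (cube d s (s + s))); first by rewrite muc addrK.
    by rewrite integral_indic// setIT.
  exact/measurable_EFinP.
rewrite EFinM -intf.
have mind' : lmeas (fun y : V => (\1_(cube d s (s + s)) y)%:E : \bar R).
  exact/measurable_EFinP/(lmeas_borel mind).
have ind0 (y : V) : (0 <= (\1_(cube d s (s + s)) y)%:E :> \bar R)%E.
  by rewrite lee_fin.
have fr0 : (0 <= (f (r *: theta))%:E)%E by rewrite lee_fin.
have K0' : (0 <= K%:E)%E by rewrite lee_fin ltW.
rewrite -(lintZl mind' ind0 fr0) -(lintZl mef ef0 K0').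
apply: le_lint.
- by apply: measurable_funeM; exact: mind'.
- exact: measurable_funeM.
- by move=> y; rewrite -EFinM lee_fin mulr_ge0.
- move=> y; rewrite -!EFinM lee_fin indicE.
  have [/set_mem/sum_le|_] := boolP (y \in _); first by rewrite mulr1.
  by rewrite mulr0 mulr_ge0// ltW.
Qed.

(* The convolution square is almost radial too: reflect [x] to [|x| theta]. *)
Lemma conv_sqr_ray x :
  (conv ef ef x <= (K * K)%:E * conv ef ef (enorm x *: theta)%R)%E.
Proof.
have xt : enorm x = enorm (enorm x *: theta) by rewrite enorm_ray// enorm_ge0.
set u := x - enorm x *: theta; have Tx := householder_swap xt.
have fT z : f z <= K * f (householder u z).
  have [->|z0] := eqVneq z 0.
    rewrite (_ : householder u 0 = 0) ?ler_peMl//.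
    by apply: enorm_eq0; rewrite enorm_householder enorm0.
  by apply: f_decr; rewrite -?enorm_gt0 enorm_householder// enorm_gt0.
have mi := lmeas_conv_integrand (enorm x *: theta) mef mef.
have i0 y : (0 <= ef (enorm x *: theta - y)%R * ef y)%E.
  by rewrite mule_ge0.
have -> : conv ef ef (enorm x *: theta)%R =
  lebesgue_int (fun y => ef (enorm x *: theta - y)%R * ef y)%E by [].
rewrite -(lint_householder u mi i0) -lintZl; first last.
- by rewrite lee_fin mulr_ge0// ltW.
- by move=> y.
- exact: (lmeas_householder u mi).
apply: le_lint.
- exact: lmeas_conv_integrand.
- by apply: measurable_funeM; exact: (lmeas_householder u mi).
- by move=> y; rewrite mule_ge0.
move=> y; rewrite /= -!EFinM lee_fin mulrACA -{1}Tx -householderB.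
by apply: ler_pM.
Qed.

Section geometric_bound.
Variable h : R.
Hypothesis fh : tail_class theta gamma f h.

(** On the ray the ratio is eventually at most [h + h + 1]; [conv_sqr_ray] extends this to all
    directions at the cost of [K * K], and one more [K] leads back to [f x]. *)
Lemma conv_sqr_bound : exists C T : R, [/\ 0 < C, 0 < T &
  forall x, T <= enorm x -> (conv ef ef x <= (C * f x)%:E)%E].
Proof.
have := cvge_eps (tail_conv fh) ltr01 => -[M [_ MP]].
have h0 : 0 <= h + h + 1.
  have : (0 <= h%:E)%E.
    rewrite -(tail_moment fh); apply: lint_ge0 => y.
    by rewrite mule_ge0// lee_fin expR_ge0.
  by rewrite lee_fin => ?; lra.
exists (K * K * (h + h + 1) * K + 1), (Num.max (M + 1) 1); split.
- by rewrite ltr_wpDl// !mulr_ge0// ltW.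
- by rewrite lt_max ltr01 orbT.
move=> x; rewrite ge_max => /andP[Mx x1].
have t0 : 0 < enorm x by exact: lt_le_trans x1.
apply: le_trans (conv_sqr_ray x) _.
have Mx' : M < enorm x by lra.
have [_] := MP (enorm x) Mx'.
rewrite lee_pdivrMr ?fray// => cx.
apply: (@le_trans _ _ ((K * K)%:E * ((h + h + 1)%:E * (f (enorm x *: theta))%:E))%E).
  by rewrite lee_pmul2l ?lte_fin ?mulr_gt0.
rewrite -!EFinM lee_fin [leRHS]mulrDl -!mulrA.
have : f (enorm x *: theta) <= K * f x.
  by apply: f_decr; rewrite -?enorm_gt0// enorm_ray// ltW.
move=> fx; apply: (@le_trans _ _ (K * (K * ((h + h + 1) * (K * f x))))).
  by do 2 (rewrite ler_pM2l//); rewrite ler_wpM2l.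
by rewrite lerDl mul1r.
Qed.

(* Kesten-type bound. Near the origin it comes from [nconv_pigeonhole]; far
   away, induct on [n], splitting the convolution at [|x - y| = 1]. *)
Lemma nconv_bound : exists M A : R, [/\ 0 < M, 0 < A &
  forall n x, 1 <= enorm x -> (fpow n x <= (M * A ^+ n.+1 * f x)%:E)%E].
Proof.
have [C2 [R2 [C20 R20 sqr]]] := conv_sqr_bound.
have [C1 [R1 [C10 R10 fs]]] :=
  @shift_bound _ _ f theta gamma K theta1 fgt0 K1 f_decr f_shift 1 ler01.
pose T := Num.max R2 (Num.max R1 1).
have T1 : 1 <= T by rewrite !le_max lexx !orbT.
have T0 : 0 < T by exact: lt_le_trans T1.
have fT := fray T0.
(* With radius [1 / n.+1], the pigeonhole and volume bounds give [n.+1 ^ d.+1 * m ^ n.+1] up to the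
   constant [M1]; the polynomial factor is absorbed by [n.+1 <= 2 ^ n.+1]. *)
pose A1 := 2 ^+ d.+1 * (m + 1).
have m10 : 0 < m + 1 by rewrite ltr_wpDl.
have A10 : 0 < A1 by rewrite mulr_gt0// exprn_gt0.
have d0' : 0 < d%:R :> R by rewrite ltr0n.
pose M1 := K * (K * (2 * d%:R) ^+ d).
have M10 : 0 < M1 by rewrite !mulr_gt0// exprn_gt0// mulr_gt0.
have small n x : 1 <= enorm x -> (fpow n x <= (M1 * A1 ^+ n.+1)%:E)%E.
  move=> x1; have n0 : 0 < n.+1%:R^-1 :> R by rewrite invr_gt0.
  apply: le_trans (@nconv_pigeonhole n _ x n0 _) _; first by rewrite divff.
  rewrite lee_fin.
  have := ray_volume_bound n0; set F := f _ => FK.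
  have {}FK : F <= K * m * (2 * d%:R) ^+ d * n.+1%:R ^+ d.
    move: FK; have -> : (n.+1%:R^-1 / (2 * d%:R)) ^+ d =
        ((2 * d%:R) ^+ d * n.+1%:R ^+ d)^-1 :> R.
      by rewrite -exprMn -exprVn [in RHS]invfM [in RHS]mulrC.
    by rewrite ler_pdivrMr ?mulr_gt0 ?exprn_gt0 ?mulr_gt0// mulrA.
  have n2 : n.+1%:R <= 2 ^+ n.+1 :> R by rewrite -natrX ler_nat ltnW// ltn_expl.
  have nd : n.+1%:R ^+ d.+1 <= (2 ^+ d.+1) ^+ n.+1 :> R.
    by rewrite -exprM mulnC exprM lerXn2r ?nnegrE ?exprn_ge0 ?ler0n.
  apply: (@le_trans _ _ (M1 * (n.+1%:R ^+ d.+1 * m ^+ n.+1))).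
    rewrite (_ : M1 * _ = n.+1%:R * (K * (K * m * (2 * d%:R) ^+ d * n.+1%:R ^+ d)) *
      m ^+ n); last by rewrite /M1 !exprS; ring.
    by rewrite ler_wpM2r ?exprn_ge0// ler_wpM2l ?ler0n// ler_wpM2l// ltW.
  rewrite ler_pM2l// /A1 exprMn ler_pM ?exprn_ge0 ?ler0n//.
  by rewrite lerXn2r ?nnegrE ?lerDl// ltW.
(* In [A], the summand [A1] serves the bounded region, [C2 + C1] closes the induction and [m]
   dominates the mass of the powers. The quotient in [M] turns a constant into a multiple of [f x],
   since [f (T *: theta) <= K * f x] there. *)
pose A := A1 + C2 + C1 + m + 1; pose M := 1 + M1 * K / f (T *: theta).
have m0' := m0.
have A0 : 1 <= A by rewrite /A; lra.
have Apos : 0 < A by lra.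
have MT : 0 < M1 * K / f (T *: theta) by rewrite divr_gt0// mulr_gt0.
have M0 : 1 <= M by rewrite /M; lra.
have Mpos : 0 < M by lra.
have mid n x : 1 <= enorm x -> enorm x <= T ->
    (fpow n x <= (M * A ^+ n.+1 * f x)%:E)%E.
  move=> x1 xT; have x0 : x != 0 by rewrite -enorm_gt0; lra.
  apply: le_trans (small n x x1) _; rewrite lee_fin.
  have fTx : f (T *: theta) <= K * f x.
    by apply: f_decr => //; rewrite enorm_ray// ltW.
  apply: (@le_trans _ _ (M1 * A ^+ n.+1)).
    rewrite ler_pM2l// ler_pXn2r ?nnegrE ?ltW//; rewrite /A; lra.
  rewrite [leRHS]mulrAC ler_pM2r ?exprn_gt0//.
  apply: (@le_trans _ _ (M1 * K / f (T *: theta) * f x)); last first.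
    by rewrite ler_wpM2r// /M lerDr.
  by rewrite [leRHS]mulrAC ler_pdivlMr// -[leRHS]mulrA ler_pM2l.
exists M, A; split => //; elim=> [|n IH] x x1.
  rewrite lee_fin expr1 -[leLHS]mul1r ler_wpM2r//.
  by rewrite -[1]mulr1 ler_pM.
have [|/ltW Tx] := leP (enorm x) T; first exact: mid.
have {Tx} [xR2 xR1] : R2 <= enorm x /\ R1 <= enorm x.
  by move: Tx; rewrite /T !ge_max => /andP[-> /andP[-> _]].
set B := M * A ^+ n.+1; have B0 : 0 <= B by rewrite mulr_ge0 ?exprn_ge0// ltW.
pose u y : \bar R := (B%:E * (ef (x - y)%R * ef y))%E.
have mu_ : lmeas u by apply: measurable_funeM; exact: lmeas_conv_integrand.
have u0 y : (0 <= u y)%E by rewrite !mule_ge0// lee_fin.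
have cf0 : 0 <= C1 * f x by rewrite mulr_ge0// ltW.
rewrite nconvS.
apply: le_trans (conv_le_split (mpow n) (pow0 n) mu_ u0 cf0 _) _.
  (* For [x - y] outside the unit ball the induction hypothesis reduces to the convolution square;
     otherwise [y] is within distance [1] of [x], so [f y] is at most [C1 * f x]. *)
  move=> y; have [xy|/ltW xy] := leP 1 (enorm (x - y)).
    apply: (@le_trans _ _ (u y)); last by rewrite leeDl// mule_ge0.
    rewrite /u muleA; apply: lee_wpmul2r; first by rewrite lee_fin.
    by rewrite -EFinM; exact: IH.
  apply: (@le_trans _ _ ((C1 * f x)%:E * fpow n (x - y)%R)%E); last first.
    by rewrite leeDr.
  rewrite muleC; apply: lee_wpmul2r => //; rewrite lee_fin.
  by have := fs x (x - y) xR1 xy; rewrite opprB addrC subrK.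
rewrite (lintZl (lmeas_conv_integrand x mef mef)); first last.
- by rewrite lee_fin.
- by move=> y; rewrite mule_ge0.
rewrite (lint_nconv mef ef0 intf).
apply: (@le_trans _ _ (B%:E * (C2 * f x)%:E + (C1 * f x)%:E * (m ^+ n.+1)%:E)%E).
  by apply: leeD => //; apply: lee_wpmul2l; [rewrite lee_fin|exact: sqr].
rewrite -!EFinM -EFinD lee_fin.
have mB : m ^+ n.+1 <= B.
  have mA : m <= A by rewrite /A; lra.
  by rewrite /B -[leLHS]mul1r ler_pM ?exprn_ge0// lerXn2r ?nnegrE// ltW.
apply: (@le_trans _ _ (B * (C2 * f x) + C1 * f x * B)).
  by rewrite lerD2l ler_wpM2l.
have -> : M * A ^+ n.+2 = B * A by rewrite /B exprSr mulrA.
rewrite (_ : _ + _ = B * (C2 + C1) * f x); last by ring.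
by rewrite ler_wpM2r// ler_wpM2l// /A; lra.
Qed.

End geometric_bound.

End almost_radial_bounds.

(** * Series of non-negative terms *)

Section series_tools.
Context {R : realType}.
Local Open Scope ereal_scope.

(** For infinite [x] the product is infinite or zero, and both sides are [0]. *)
Lemma fine_mulr (x : \bar R) (r : R) : fine (x * r%:E) = (fine x * r)%R.
Proof.
case: x => [x| |]//=; rewrite ?mul0r.
- by rewrite mulyr; case: sgrP => _; rewrite ?mul0e ?mul1e ?mulN1e.
- by rewrite mulNyr; case: sgrP => _; rewrite ?mul0e ?mul1e ?mulN1e.
Qed.

Lemma exp_series (x : R) : (0 <= x)%R ->
  \sum_(k <oo) (x ^+ k / k`!%:R)%:E = (expR x)%:E.
Proof.
move=> x0; rewrite /expR -EFin_lim; last exact: is_cvg_series_exp_coeff.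
by apply/congr_lim/funext => n; rewrite /= sumEFin.
Qed.

Lemma exp_seriesS_le (x : R) : (0 <= x)%R ->
  \sum_(k <oo) (x ^+ k.+1 / k.+1`!%:R)%:E <= (expR x)%:E.
Proof.
move=> x0; have c0 k : 0 <= (x ^+ k / k`!%:R)%:E.
  by rewrite lee_fin divr_ge0// exprn_ge0.
rewrite -exp_series// (nneseries_recl (fun k _ => c0 k))//.
rewrite -(nneseries_addn 1 c0); under [X in X <= _]eq_eseriesr do rewrite -addn1.
by rewrite leeDr.
Qed.

Lemma nneseries_counting (u : nat -> R) : (forall k, (0 <= u k)%R) ->
  \sum_(k <oo) (u k)%:E = \int[counting]_k (u k)%:E.
Proof. by move=> u0; rewrite ge0_integral_count// => k; rewrite lee_fin. Qed.

(* Tannery's theorem, as dominated convergence for the counting measure. *)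
Lemma tannery (u : nat -> nat -> R) (l v : nat -> R) :
  (forall n k, (0 <= u n k)%R) ->
  (\forall n \near \oo, forall k, (u n k <= v k)%R) ->
  (forall k, u ^~ k @ \oo --> l k) -> \sum_(k <oo) (v k)%:E < +oo ->
  (forall k, (0 <= v k)%R) ->
  \sum_(k <oo) (u n k)%:E @[n --> \oo] --> \sum_(k <oo) (l k)%:E.
Proof.
move=> u0 uv ul voo v0.
have l0 k : (0 <= l k)%R.
  by apply: (ler_cvg_to (cvg_cst 0%R) (ul k)); exact: nearW.
rewrite nneseries_counting//.
have -> : (fun n => \sum_(k <oo) (u n k)%:E) =
    fun n => \int[counting]_k (u n k)%:E.
  by apply/funext => n; rewrite nneseries_counting.
apply: (@pratt R _ _ (@counting nat R) u (fun _ => v) l v) => //.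
- by move=> x; exact: cvg_cst.
- by rewrite -nneseries_counting.
- exact: cvg_cst.
Qed.

End series_tools.

(** * The compound Poisson density: lower bounds, measurability and moments *)

Section poisson_facts.
Context {R : realType} {d : nat}.
Local Notation V := 'rV[R]_d.
Variables (f : V -> R) (m : R).
Hypothesis mf : lmeas f.
Hypothesis f0 : forall x, 0 <= f x.
Hypothesis intf : lebesgue_int (EFin \o f) = m%:E.
Implicit Types (x y z : V) (r t : R).

Local Notation ef := (EFin \o f).
Local Notation fpow n := (nconv (EFin \o f) n.+1).
Local Notation p := (poisson_density f).

Let mef : lmeas ef. Proof. exact/measurable_EFinP/mf. Qed.

Let ef0 x : (0 <= ef x)%E. Proof. by rewrite lee_fin. Qed.

Let mpow n : lmeas (fpow n). Proof. exact: lmeas_nconv. Qed.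

Let pow0 n x : (0 <= fpow n x)%E. Proof. exact: nconv_ge0. Qed.

Lemma lmeas_series (u : nat -> V -> \bar R) : (forall k, lmeas (u k)) ->
  (forall k x, 0 <= u k x)%E -> lmeas (fun x => \sum_(k <oo) u k x)%E.
Proof.
move=> mu u0; rewrite (_ : (fun x => _) =
    (fun x => \sum_(k <oo | k \in xpredT) u k x)%E); last exact/funext.
by apply: ge0_emeasurable_sum => [k x _ _|k _]; [exact: u0|exact: mu].
Qed.

Lemma lebesgue_ae_eq_fine_pow n : lebesgue_ae_eq (fpow n) (EFin \o (fine \o fpow n)).
Proof.
apply: lint_fin_ae; [exact: mpow|exact: pow0|].
by rewrite (lint_nconv mef ef0 intf) ltry.
Qed.

Lemma lmeas_fine (q : V -> \bar R) : lmeas q -> lmeas (fine \o q).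
Proof. by move=> mq; apply: (measurableT_comp _ mq); exact: fine_measurable. Qed.

(** The real-valued predicate [tame] forces finite parts. A power has finite integral, hence is
    finite almost everywhere, and the next power does not notice the change. *)
Lemma nconvS_fine n : conv (EFin \o (fine \o fpow n)) ef = fpow n.+1.
Proof.
rewrite nconvS; apply/esym/conv_ae => //.
- exact/measurable_EFinP/lmeas_fine.
- by move=> y; rewrite lee_fin fine_ge0.
- exact: lebesgue_ae_eq_fine_pow.
- exact: aeW.
Qed.

Lemma L1norm_density : L1norm f = m.
Proof.
rewrite /L1norm (_ : (fun x => _) = ef) ?intf//.
by apply/funext => x /=; rewrite ger0_norm.
Qed.

Variable lam : R.
Hypothesis lam0 : 0 < lam.

Let c k : R := lam ^+ k.+1 / k.+1`!%:R.

Let c0 k : 0 <= c k.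
Proof. by rewrite divr_ge0// exprn_ge0// ltW. Qed.

Let term0 k x : (0 <= (c k)%:E * fpow k x)%E.
Proof. by rewrite mule_ge0// lee_fin. Qed.

Lemma poisson_densityE x : p lam x = ((expR (- (lam * m)))%:E *
  \sum_(k <oo) (lam ^+ k.+1 / k.+1`!%:R)%:E * fpow k x)%E.
Proof.
rewrite /poisson_density L1norm_density; congr (_ * _)%E.
have g0 k : (0 <= (lam ^+ k / k`!%:R)%:E * nconv ef k x)%E.
  case: k => [|k]; last exact: term0.
  apply: mule_ge0; last exact: ef0.
  by rewrite lee_fin expr0 mul1r invr_ge0.
rewrite -(nneseries_addn 1 g0).
by apply: eq_eseriesr => k _; rewrite addn1.
Qed.

Let e0 : 0 <= expR (- (lam * m)). Proof. exact: expR_ge0. Qed.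

Lemma poisson_ge0 x : (0 <= p lam x)%E.
Proof.
rewrite poisson_densityE; apply: mule_ge0; first by rewrite lee_fin.
by apply: nneseries_ge0 => k _ _; exact: term0.
Qed.

Lemma poisson_ge12 x :
  ((expR (- (lam * m)))%:E * ((lam * f x)%:E + (lam ^+ 2 / 2)%:E * conv ef ef x)
   <= p lam x)%E.
Proof.
rewrite poisson_densityE lee_pmul2l ?lte_fin ?expR_gt0//.
apply: le_trans (nneseries_lim_ge 2 (fun k _ _ => term0 k x)).
by rewrite !big_nat_recl//= big_geq// adde0 /c expr1 divr1 EFinM.
Qed.

Lemma poisson_ge1 x : ((expR (- (lam * m)) * lam * f x)%:E <= p lam x)%E.
Proof.
apply: le_trans (poisson_ge12 x); rewrite -mulrA EFinM.
rewrite lee_pmul2l ?lte_fin ?expR_gt0// leeDl// mule_ge0//.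
  by rewrite lee_fin divr_ge0// exprn_ge0// ltW.
by apply: conv_ge0.
Qed.

Lemma lmeas_poisson : lmeas (p lam).
Proof.
rewrite (_ : p lam = fun x => (expR (- (lam * m)))%:E *
    \sum_(k <oo) (c k)%:E * fpow k x)%E; last first.
  by apply/funext => x; rewrite poisson_densityE.
apply: measurable_funeM; apply: lmeas_series => [k|]; last exact: term0.
by apply: measurable_funeM; exact: mpow.
Qed.

(** Moments are multiplicative under convolution, so integrating term by term leaves an exponential
    series in [lam * k]. *)
Lemma exp_moment_poisson (theta : V) (gamma k : R) :
  exp_moment theta gamma ef = k%:E ->
  (exp_moment theta gamma (p lam) < +oo)%E.
Proof.
move=> fk; have k0 : 0 <= k.
  rewrite -lee_fin -fk; apply: lint_ge0 => y.
  by rewrite mule_ge0// lee_fin ?expR_ge0.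
have me := @lmeas_expdot R d theta gamma.
have e0' y : (0 <= (expR (gamma * dot theta y))%:E)%E.
  by rewrite lee_fin expR_ge0.
have meach n : lmeas (fun y => (c n)%:E *
    ((expR (gamma * dot theta y))%:E * fpow n y))%E.
  by apply: measurable_funeM; exact: (emeasurable_funM me (mpow n)).
have each0 n y : (0 <= (c n)%:E *
    ((expR (gamma * dot theta y))%:E * fpow n y))%E.
  by rewrite !mule_ge0// lee_fin.
have mser : lmeas (fun y => \sum_(n <oo) ((c n)%:E *
    ((expR (gamma * dot theta y))%:E * fpow n y)))%E.
  exact: lmeas_series.
rewrite (_ : exp_moment _ _ _ = ((expR (- (lam * m)))%:E * lebesgue_int
  (fun y => \sum_(n <oo) ((c n)%:E *
    ((expR (gamma * dot theta y))%:E * fpow n y))))%E); last first.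
  rewrite -lintZl ?lee_fin//; last first.
    by move=> y; apply: nneseries_ge0 => n _ _; exact: each0.
  congr lebesgue_int; apply/funext => y.
  rewrite poisson_densityE muleCA; congr (_ * _)%E.
  rewrite -(nneseriesZl _ 0 (fun k (_ : xpredT k) => term0 k y)).
  apply: eq_eseriesr => n _.
  by rewrite muleCA.
apply: lte_mul_pinfty => //.
rewrite /lebesgue_int.
rewrite (integral_nneseries _ measurableT meach (fun n y _ => each0 n y)).
apply: (@le_lt_trans _ _ (\sum_(n <oo) ((lam * k) ^+ n.+1 / n.+1`!%:R)%:E)%E).
  apply: lee_nneseries => n _; first by move=> _; exact: integral_ge0.
  have := @lintZl R d _ (c n)%:E (emeasurable_funM me (mpow n)) _ _.
  rewrite /lebesgue_int => ->; rewrite ?lee_fin//; last first.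
    by move=> y; rewrite mule_ge0.
  rewrite [X in (_ * X)%E](_ : _ = (k ^+ n.+1)%:E).
    by rewrite -EFinM lee_fin /c exprMn mulrAC.
  exact: (exp_moment_nconv mef ef0 fk).
apply: le_lt_trans (exp_seriesS_le _) _; last exact: ltry.
by rewrite mulr_ge0// ltW.
Qed.

End poisson_facts.

(** * Finite parts of functions with values in the extended reals *)

Section finite_parts.
Context {R : realType} {d : nat}.
Local Notation V := 'rV[R]_d.
Implicit Types (q : V -> \bar R) (theta y : V) (gamma : R).

Lemma fine_le_EFin (x : \bar R) (r : R) :
  (0 <= x)%E -> (x <= r%:E)%E -> fine x <= r.
Proof. by case: x => [x| |]. Qed.

Lemma le_EFin_fine (x : \bar R) (r : R) :
  (0 <= x)%E -> (x <= r%:E)%E -> x = (fine x)%:E.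
Proof. by case: x => [x| |]. Qed.

Lemma exp_moment_ae theta gamma q q' : lmeas q -> lmeas q' ->
  (forall y, 0 <= q y)%E -> (forall y, 0 <= q' y)%E -> lebesgue_ae_eq q q' ->
  exp_moment theta gamma q = exp_moment theta gamma q'.
Proof.
move=> mq mq' q0 q'0 qq'; apply: lint_ae.
- exact: (emeasurable_funM (lmeas_expdot theta gamma) mq).
- exact: (emeasurable_funM (lmeas_expdot theta gamma) mq').
- by move=> y; rewrite mule_ge0// lee_fin expR_ge0.
- by move=> y; rewrite mule_ge0// lee_fin expR_ge0.
- by apply: ae_lebesgueS qq' => y ->.
Qed.

(** Taking finite parts alters [q] on a null set only, and nowhere far out, where the bound by [f]
    makes [q] finite. *)
Lemma tame_fine (f : V -> R) theta gamma q (a k C T : R) :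
  lmeas q -> (forall y, 0 <= q y)%E -> 0 <= C ->
  (forall x, T <= enorm x -> (q x <= (C * f x)%:E)%E) ->
  (lebesgue_int q < +oo)%E -> 0 <= a -> exp_moment theta gamma q = k%:E ->
  (forall y, (q (t *: theta - y)%R * (f (t *: theta))^-1%:E)%E @[t --> +oo] -->
    (a * expR (gamma * dot theta y))%:E) ->
  tame f theta gamma (fine \o q) a k.
Proof.
move=> mq q0 C0 qC qoo a0 qk lim.
have ae := lint_fin_ae mq q0 qoo.
have mfq := lmeas_fine mq.
have mefq : lmeas (EFin \o (fine \o q)) by exact/measurable_EFinP/mfq.
have fq0 y : 0 <= (fine \o q) y by exact: fine_ge0.
have efq0 y : (0 <= (EFin \o (fine \o q)) y)%E by rewrite lee_fin.
apply: Build_tame => //.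
- by exists C, T; split => // x xT; apply: fine_le_EFin => //; exact: qC.
- by rewrite -(lint_ae mq mefq q0 efq0 ae).
- by rewrite -(exp_moment_ae theta gamma mq mefq q0 efq0 ae).
- move=> y; have /fine_cvgP[_] := lim y.
  apply: cvg_trans; apply: near_eq_cvg.
  by apply: nearW => t; rewrite /= fine_mulr.
Qed.

End finite_parts.

(** * Asymptotics of the compound Poisson density *)

Section poisson_tail.
Context {R : realType} {d : nat}.
Local Notation V := 'rV[R]_d.
Variables (f : V -> R) (theta : V) (gamma K m : R).
Hypothesis d0 : (0 < d)%N.
Hypothesis theta1 : enorm theta = 1.
Hypothesis mf : lmeas f.
Hypothesis f0 : forall x, 0 <= f x.
Hypothesis fgt0 : forall x, x != 0 -> 0 < f x.
Hypothesis K1 : 1 <= K.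
Hypothesis f_decr : forall z w : V,
  w != 0 -> enorm w <= enorm z -> f z <= K * f w.
Hypothesis intf : lebesgue_int (EFin \o f) = m%:E.
Hypothesis f_shift : ray_limit theta gamma f (fun t => f (t *: theta)) 1.
Implicit Types (x y z : V) (r t : R).

Local Notation ef := (EFin \o f).
Local Notation fpow n := (nconv (EFin \o f) n.+1).
Local Notation p := (poisson_density f).

Let enorm_ray t : 0 <= t -> enorm (t *: theta) = t.
Proof. by move=> t0; rewrite enormZ theta1 mulr1 ger0_norm. Qed.

Let fray t : 0 < t -> 0 < f (t *: theta).
Proof. by move=> t0; apply/fgt0; rewrite -enorm_gt0 enorm_ray// ltW. Qed.

Let mef : lmeas ef. Proof. exact/measurable_EFinP/mf. Qed.

Let ef0 x : (0 <= ef x)%E. Proof. by rewrite lee_fin. Qed.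

Let mpow n : lmeas (fpow n). Proof. exact: lmeas_nconv. Qed.

Let pow0 n x : (0 <= fpow n x)%E. Proof. exact: nconv_ge0. Qed.

Section tail.
Variable h : R.
Hypothesis fh : tail_class theta gamma f h.

Lemma tail_moment_ge0 : 0 <= h.
Proof.
rewrite -lee_fin -(tail_moment fh); apply: lint_ge0 => y.
by rewrite mule_ge0// lee_fin expR_ge0.
Qed.

Let h0 := tail_moment_ge0.

Lemma tame_density : tame f theta gamma f 1 h.
Proof.
apply: (Build_tame mf f0 _ _ ler01 (tail_moment fh) f_shift).
  by exists 1, 0; split => // x _; rewrite mul1r.
by rewrite intf ltry.
Qed.

(** One of the [n.+1] summands makes the large jump and each of the others contributes a moment [h];
    [conv_ray] provides the recursion and [nconv_bound] the domination. *)
Lemma tame_nconv n :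
  tame f theta gamma (fine \o fpow n) (n.+1%:R * h ^+ n) (h ^+ n.+1).
Proof.
have [M [A [M0 A0 bound]]] :=
  nconv_bound d0 theta1 mf f0 fgt0 K1 f_decr intf f_shift fh.
elim: n => [|n IH].
  by rewrite mulr1 expr1; exact: tame_density.
apply: (@tame_fine _ _ f theta gamma (fpow n.+1) _ _ (M * A ^+ n.+2) 1).
- exact: mpow.
- exact: pow0.
- by rewrite mulr_ge0 ?exprn_ge0// ltW.
- by move=> x x1; exact: bound.
- by rewrite (lint_nconv mef ef0 intf) ltry.
- by rewrite mulr_ge0 ?exprn_ge0.
- exact: (exp_moment_nconv mef ef0 (tail_moment fh)).
- move=> y.
  have := conv_ray theta1 f0 fgt0 K1 f_decr f_shift (z := y) fh IH tame_density.
  rewrite (nconvS_fine mf f0 intf).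
  rewrite (_ : n.+1%:R * h ^+ n * h + 1 * h ^+ n.+1 = n.+2%:R * h ^+ n.+1)//.
  by rewrite -[n.+2%:R]natr1 exprS; ring.
Qed.

Variable lam : R.
Hypothesis lam0 : 0 < lam.

(** The closed form of the exponential prefactor times the sum over [n >= 1] of [lam ^ n / n!] times
    the ratio [n * h ^ (n - 1)] of the [n]-th power. *)
Definition poisson_coef : R := expR (- (lam * m)) * (lam * expR (lam * h)).

Lemma poisson_coef_gt0 : 0 < poisson_coef.
Proof. by rewrite !mulr_gt0 ?expR_gt0. Qed.

(** The bound of [nconv_bound] grows only geometrically in [n], so the weights [lam ^ n / n!] sum it
    to an exponential. *)
Lemma poisson_bound : exists2 C : R, 0 < C &
  forall x, 1 <= enorm x -> (p lam x <= (C * f x)%:E)%E.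
Proof.
have [M [A [M0 A0 bound]]] :=
  nconv_bound d0 theta1 mf f0 fgt0 K1 f_decr intf f_shift fh.
have lA0 : 0 <= lam * A by rewrite mulr_ge0// ltW.
exists (expR (- (lam * m)) * (M * expR (lam * A))) => [|x x1].
  by rewrite !mulr_gt0 ?expR_gt0.
rewrite (poisson_densityE f0 intf lam0) -mulrA EFinM.
rewrite lee_pmul2l ?lte_fin ?expR_gt0//.
have Mf0 : 0 <= M * f x by rewrite mulr_ge0// ltW.
have c0 k : 0 <= (lam * A) ^+ k.+1 / k.+1`!%:R.
  by rewrite divr_ge0// exprn_ge0.
apply: (@le_trans _ _ ((M * f x)%:E *
    \sum_(k <oo) ((lam * A) ^+ k.+1 / k.+1`!%:R)%:E)%E).
  rewrite -nneseriesZl; last by move=> k _; rewrite lee_fin.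
  apply: lee_nneseries => k _.
    by move=> _; rewrite mule_ge0// lee_fin divr_ge0// exprn_ge0// ltW.
  apply: (@le_trans _ _ ((lam ^+ k.+1 / k.+1`!%:R)%:E *
      (M * A ^+ k.+1 * f x)%:E)%E).
    apply: lee_wpmul2l; last exact: bound.
    by rewrite lee_fin divr_ge0// exprn_ge0// ltW.
  rewrite -!EFinM lee_fin exprMn le_eqVlt; apply/orP; left; apply/eqP; ring.
rewrite (_ : M * expR (lam * A) * f x = M * f x * expR (lam * A)); last by ring.
by rewrite [leRHS]EFinM; apply: lee_wpmul2l; [rewrite lee_fin|exact: exp_seriesS_le].
Qed.

Lemma poisson_limit y :
  (p lam (t *: theta - y)%R * (f (t *: theta))^-1%:E)%E @[t --> +oo] -->
  (poisson_coef * expR (gamma * dot theta y))%:E.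
Proof.
have [M [A [M0 A0 bound]]] :=
  nconv_bound d0 theta1 mf f0 fgt0 K1 f_decr intf f_shift fh.
have [Cs [Ts [Cs0 Ts0 fs]]] :=
  shift_bound theta1 fgt0 K1 f_decr f_shift (enorm_ge0 y).
set E := expR (gamma * dot theta y).
apply/cvge_pinftyP => u uoo.
pose c k : R := lam ^+ k.+1 / k.+1`!%:R.
have c0 k : 0 <= c k by rewrite divr_ge0// exprn_ge0// ltW.
pose X n := u n *: theta - y.
pose U n k := if 1 <= enorm (X n)
  then c k * (fine (fpow k (X n)) / f (u n *: theta)) else 0.
(* The summable majorant for Tannery's theorem: [nconv_bound] gives a multiple of [f (X n)], and
   [shift_bound] trades this for [Cs * f (u n *: theta)]. In the limit [l], the factor [k.+1] of the
   ratio cancels against the factorial. *)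
pose v k := (M * Cs) * ((lam * A) ^+ k.+1 / k.+1`!%:R).
pose l k := (lam * E) * ((lam * h) ^+ k / k`!%:R).
have large : \forall n \near \oo,
    [/\ 1 <= enorm (X n), Ts <= u n & 0 < u n].
  have /cvgryPge/(_ (enorm y + 1 + Ts)) := uoo; apply: filterS => n un.
  have y0 := enorm_ge0 y.
  have un0 : 0 < u n by lra.
  split => //; last by lra.
  have : u n - enorm y <= enorm (X n).
    by rewrite -{1}(enorm_ray (ltW un0)); exact: enorm_sub_ge.
  by lra.
have UT : (\sum_(k <oo) (U n k)%:E)%E @[n --> \oo] --> (\sum_(k <oo) (l k)%:E)%E.
  apply: (@tannery _ U l v).
  - move=> n k; rewrite /U; case: ifP => // _.
    by apply: mulr_ge0 => //; apply: divr_ge0 => //; exact: fine_ge0.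
  - apply: filterS large => n [X1 uT u0] k; rewrite /U X1.
    have fu := fray u0.
    rewrite (_ : v k = c k * (M * A ^+ k.+1 * Cs)); last first.
      by rewrite /v /c exprMn; ring.
    rewrite ler_wpM2l// ler_pdivrMr//.
    apply: (@le_trans _ _ (M * A ^+ k.+1 * f (X n))).
      by apply: fine_le_EFin => //; exact: bound.
    rewrite -[leRHS]mulrA ler_wpM2l//.
      by rewrite mulr_ge0 ?exprn_ge0// ltW.
    by apply: fs => //; rewrite enorm_ray// ltW.
  - move=> k; have lim := cvg_comp _ _ uoo
      (@tame_limit _ _ _ _ _ _ _ _ (tame_nconv k) y).
    have {}lim : c k * (fine (fpow k (X n)) / f (u n *: theta)) @[n --> \oo] -->
        c k * (k.+1%:R * h ^+ k * E).
      by apply: cvgM; [exact: cvg_cst|exact: lim].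
    rewrite (_ : l k = c k * (k.+1%:R * h ^+ k * E)); last first.
      rewrite /l /c factS natrM exprMn exprS; field.
      by rewrite addrC natr1 !pnatr_eq0 -lt0n fact_gt0.
    move: lim; apply: cvg_trans; apply: near_eq_cvg.
    by apply: filterS large => n [X1 _ _]; rewrite /U X1.
  - have vE k : (v k)%:E =
        ((M * Cs)%:E * ((lam * A) ^+ k.+1 / k.+1`!%:R)%:E)%E by rewrite -EFinM.
    rewrite (eq_eseriesr (fun k _ => vE k)) nneseriesZl; last first.
      by move=> k _; rewrite lee_fin divr_ge0// exprn_ge0// mulr_ge0// ltW.
    apply: lte_mul_pinfty => //; first by rewrite lee_fin mulr_ge0// ltW.
    apply: le_lt_trans (exp_seriesS_le _) (ltry _).
    by rewrite mulr_ge0// ltW.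
  - move=> k; rewrite /v mulr_ge0//; first by rewrite mulr_ge0// ltW.
    by rewrite divr_ge0// exprn_ge0// mulr_ge0// ltW.
have lh0 : 0 <= lam * h by rewrite mulr_ge0// ltW.
have lE : (\sum_(k <oo) (l k)%:E)%E = (lam * E * expR (lam * h))%:E.
  have lEk k : (l k)%:E = ((lam * E)%:E * ((lam * h) ^+ k / k`!%:R)%:E)%E.
    by rewrite -EFinM.
  rewrite (eq_eseriesr (fun k _ => lEk k)) nneseriesZl; last first.
    move=> k _; rewrite lee_fin; apply: divr_ge0 => //; exact: exprn_ge0.
  by rewrite exp_series// -EFinM.
rewrite lE in UT.
have {UT} := cvgeZl (erefl : (expR (- (lam * m)))%:E \is a fin_num) UT.
rewrite -EFinM (_ : expR (- (lam * m)) * (lam * E * expR (lam * h)) =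
  poisson_coef * E); last by rewrite /poisson_coef; ring.
apply: cvg_trans; apply: near_eq_cvg; apply: filterS large => n [X1 _ u0].
rewrite (poisson_densityE f0 intf lam0) -muleA; congr (_ * _)%E.
have ci0 k : (0 <= (c k)%:E * fpow k (X n))%E by rewrite mule_ge0// lee_fin.
rewrite muleC -(nneseriesZl _ 0 (fun k (_ : xpredT k) => ci0 k)).
apply: eq_eseriesr => k _; rewrite /U X1.
rewrite [fpow k (X n)](le_EFin_fine (pow0 k _) (bound k _ X1)) -!EFinM.
by congr EFin; rewrite /= [RHS]mulrC mulrA.
Qed.

Lemma poisson_moment : exists k : R, exp_moment theta gamma (p lam) = k%:E.
Proof.
exists (fine (exp_moment theta gamma (p lam))); rewrite fineK// ge0_fin_numE.
  exact: (exp_moment_poisson mf f0 intf lam0 (tail_moment fh)).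
apply: lint_ge0 => y; rewrite mule_ge0// ?lee_fin ?expR_ge0//.
exact: (poisson_ge0 f0 intf lam0).
Qed.

End tail.

Lemma lint_poisson (lam : R) : 0 < lam -> (lebesgue_int (p lam) < +oo)%E.
Proof.
move=> lam0; rewrite -(exp_moment0 0).
by apply: (exp_moment_poisson mf f0 intf lam0 (k := m)); rewrite exp_moment0.
Qed.

Lemma tame_poisson h lam k : tail_class theta gamma f h -> 0 < lam ->
  exp_moment theta gamma (p lam) = k%:E ->
  tame f theta gamma (fine \o p lam) (poisson_coef h lam) k.
Proof.
move=> fh lam0 pk; have [C C0 pC] := poisson_bound fh lam0.
apply: (tame_fine _ _ (ltW C0) pC) => //.
- exact: (lmeas_poisson mf f0 intf lam0).
- exact: (poisson_ge0 f0 intf lam0).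
- exact: lint_poisson.
- exact/ltW/poisson_coef_gt0.
- exact: poisson_limit.
Qed.

End poisson_tail.

(** * Quotients of functions with a common normaliser *)

Section ratio_limits.
Context {R : realType}.

(** Finite limits relative to [r] make [q1] and [q2] finite for large [t], and [b > 0] makes [q2]
    positive; the extended quotient is then the real one and [r] cancels. *)
Lemma cvg_ratio (q1 q2 : R -> \bar R) (r : R -> R) (a b : R) : 0 < b ->
  (\forall t \near +oo, 0 < r t) ->
  (q1 t * (r t)^-1%:E)%E @[t --> +oo] --> a%:E ->
  (q2 t * (r t)^-1%:E)%E @[t --> +oo] --> b%:E ->
  (q1 t / q2 t)%E @[t --> +oo] --> (a / b)%:E.
Proof.
move=> b0 r0 /fine_cvgP[fin1 lim1] /fine_cvgP[fin2 lim2].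
have pos2 : \forall t \near +oo, 0 < fine (q2 t * (r t)^-1%:E)%E.
  by have /cvgr_gt/(_ 0 b0) := lim2.
have lim : fine (q1 t * (r t)^-1%:E)%E / fine (q2 t * (r t)^-1%:E)%E
    @[t --> +oo] --> a / b.
  by apply: cvgM; [exact: lim1|apply: cvgV; [rewrite gt_eqF|exact: lim2]].
have unscale (x : \bar R) (s : R) : 0 < s ->
    (x * s^-1%:E)%E \is a fin_num -> x = (fine (x * s^-1%:E)%E * s)%:E.
  move=> s0; have si : 0 < s^-1 by rewrite invr_gt0.
  case: x => [x| |]; last 2 first.
  - by rewrite gt0_mulye// lte_fin.
  - by rewrite gt0_mulNye// lte_fin.
  by move=> _; rewrite /= divfK// gt_eqF.
apply/fine_cvgP; suff E : \forall t \near +oo, (q1 t / q2 t)%E =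
    (fine (q1 t * (r t)^-1%:E)%E / fine (q2 t * (r t)^-1%:E)%E)%:E.
  split; first by apply: filterS E => t ->.
  by move: lim; apply: cvg_trans; apply: near_eq_cvg; apply: filterS E => t /= ->.
near=> t.
have rt : 0 < r t by near: t.
have ft1 : (q1 t * (r t)^-1%:E)%E \is a fin_num by near: t.
have ft2 : (q2 t * (r t)^-1%:E)%E \is a fin_num by near: t.
have pt2 : 0 < fine (q2 t * (r t)^-1%:E)%E by near: t.
rewrite [q1 t in LHS](unscale _ _ rt ft1) [q2 t in LHS](unscale _ _ rt ft2).
rewrite inver mulf_eq0 !gt_eqF//= -EFinM; congr EFin.
by rewrite invfM mulrACA divff ?mulr1// gt_eqF.
Unshelve. all: by end_near. Qed.

End ratio_limits.

(** * The implications between the four statements *)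

Section characterisation.
Context {R : realType} {d : nat}.
Local Notation V := 'rV[R]_d.
Variables (f : V -> R) (theta : V) (gamma K m : R).
Hypothesis d0 : (0 < d)%N.
Hypothesis theta1 : enorm theta = 1.
Hypothesis mf : lmeas f.
Hypothesis f0 : forall x, 0 <= f x.
Hypothesis fgt0 : forall x, x != 0 -> 0 < f x.
Hypothesis K1 : 1 <= K.
Hypothesis f_decr : forall z w : V,
  w != 0 -> enorm w <= enorm z -> f z <= K * f w.
Hypothesis intf : lebesgue_int (EFin \o f) = m%:E.
Hypothesis f_shift : ray_limit theta gamma f (fun t => f (t *: theta)) 1.
Implicit Types (x y z : V) (r t : R).

Local Notation ef := (EFin \o f).
Local Notation p := (poisson_density f).

Let enorm_ray t : 0 <= t -> enorm (t *: theta) = t.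
Proof. by move=> t0; rewrite enormZ theta1 mulr1 ger0_norm. Qed.

Let fray t : 0 < t -> 0 < f (t *: theta).
Proof. by move=> t0; apply/fgt0; rewrite -enorm_gt0 enorm_ray// ltW. Qed.

Let fray_near : \forall t \near +oo, 0 < f (t *: theta).
Proof. by exists 0; split => // t; exact: fray. Qed.

Let mef : lmeas ef. Proof. exact/measurable_EFinP/mf. Qed.

Let ef0 x : (0 <= ef x)%E. Proof. by rewrite lee_fin. Qed.

Lemma div_ray (x : \bar R) t : 0 < t ->
  (x / (f (t *: theta))%:E)%E = (x * (f (t *: theta))^-1%:E)%E.
Proof. by move=> t0; rewrite inver gt_eqF// fray. Qed.

Lemma ray_limit_EFin y : ((f (t *: theta - y))%:E * (f (t *: theta))^-1%:E)%E
  @[t --> +oo] --> (1 * expR (gamma * dot theta y))%:E.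
Proof.
apply/fine_cvgP; split; first by apply: nearW => t; rewrite -EFinM.
by have := @f_shift y.
Qed.

(** The limits in the class are taken relative to [q] itself; dividing limits relative to [f] by the
    limit [a] of [q / f] gives them. The bound by [kappa * f] provides positivity on the ray. *)
Lemma subexp_of_limits (q : V -> \bar R) (a k kappa : R) :
  lmeas q -> (forall y, 0 <= q y)%E -> (lebesgue_int q < +oo)%E ->
  0 < kappa -> (forall x, (kappa * f x)%:E <= q x)%E -> 0 < a ->
  (forall y, (q (t *: theta - y)%R * (f (t *: theta))^-1%:E)%E @[t --> +oo] -->
    (a * expR (gamma * dot theta y))%:E) ->
  exp_moment theta gamma q = k%:E ->
  (conv q q (t *: theta)%R * (f (t *: theta))^-1%:E)%E @[t --> +oo] -->
    (a * k + a * k)%:E ->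
  subexp_class theta gamma q.
Proof.
move=> mq q0 qoo kap0 kapq a0 lim qk qconv.
have lim0 : (q (t *: theta)%R * (f (t *: theta))^-1%:E)%E @[t --> +oo] --> a%:E.
  have := lim 0; rewrite dot0r mulr0 expR0 mulr1; apply: cvg_trans.
  by apply: near_eq_cvg; apply: nearW => t; rewrite subr0.
split.
- apply/integrableP; split => //.
  by under eq_integral => y _ do rewrite gee0_abs//.
- exact: q0.
- exists 1; split => // t t1; apply: lt_le_trans (kapq _).
  by rewrite lte_fin mulr_gt0// fray// (lt_le_trans ltr01 t1).
- move=> y; have := cvg_ratio a0 fray_near (lim y) lim0.
  by rewrite mulrAC divff ?mul1r// gt_eqF.
- by rewrite qk ltry.
- have := cvg_ratio a0 fray_near qconv lim0.
  rewrite (_ : (a * k + a * k) / a = 2 * k); last by field; rewrite gt_eqF.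
  by rewrite qk -EFinM.
Qed.

Lemma subexp_tail : subexp_class theta gamma ef ->
  exists h, tail_class theta gamma f h.
Proof.
case=> _ _ _ _ mom cv; set h := fine (exp_moment theta gamma ef).
have fh : exp_moment theta gamma ef = h%:E.
  rewrite fineK// ge0_fin_numE//; apply: lint_ge0 => y.
  by rewrite mule_ge0// lee_fin expR_ge0.
exists h; apply: Build_tail_class => //.
have -> : (h + h)%:E = (2%:E * exp_moment theta gamma ef)%E.
  by rewrite fh -EFinM; congr EFin; ring.
move: cv; apply: cvg_trans; apply: near_eq_cvg.
by exists 0; split => // t t0; rewrite /= -div_ray.
Qed.

Lemma tail_subexp h : tail_class theta gamma f h -> subexp_class theta gamma ef.
Proof.
move=> fh; apply: (@subexp_of_limits ef 1 h 1) => //.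
- by rewrite intf ltry.
- by move=> x; rewrite mul1r.
- exact: ray_limit_EFin.
- exact: (tail_moment fh).
- by rewrite mul1r; exact: (tail_conv fh).
Qed.

(** Apply [conv_ray] to the finite part of [p lam] paired with itself; the convolution square is the
    same at every point. *)
Lemma poisson_subexp h lam : tail_class theta gamma f h -> 0 < lam ->
  subexp_class theta gamma (p lam).
Proof.
move=> fh lam0.
have mp := lmeas_poisson mf f0 intf lam0.
have p0 := poisson_ge0 f0 intf lam0.
have poo := lint_poisson mf f0 intf lam0.
have [k pk] := poisson_moment mf f0 intf fh lam0.
have a0 := poisson_coef_gt0 m h lam0.
have tp := tame_poisson d0 theta1 mf f0 fgt0 K1 f_decr intf f_shift fh lam0 pk.
apply: (@subexp_of_limits (p lam) (poisson_coef m h lam) k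
  (expR (- (lam * m)) * lam)) => //.
- by rewrite mulr_gt0 ?expR_gt0.
- exact: poisson_ge1.
- exact: (poisson_limit d0 theta1 mf f0 fgt0 K1 f_decr intf f_shift fh lam0).
have pe : conv (EFin \o (fine \o p lam)) (EFin \o (fine \o p lam)) =
    conv (p lam) (p lam).
  have mfp : lmeas (EFin \o (fine \o p lam)).
    exact/measurable_EFinP/(lmeas_fine mp).
  have fp0 y : (0 <= (EFin \o (fine \o p lam)) y)%E by rewrite lee_fin fine_ge0.
  have ae := lint_fin_ae mp p0 poo.
  exact/esym/(conv_ae mp mp mfp mfp p0 p0 fp0 fp0 ae ae).
have := conv_ray theta1 f0 fgt0 K1 f_decr f_shift (z := 0) fh tp tp.
rewrite pe dot0r mulr0 expR0 mulr1; apply: cvg_trans.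
by apply: near_eq_cvg; apply: nearW => t; rewrite subr0.
Qed.

Lemma poisson_limsup h lam : tail_class theta gamma f h -> 0 < lam ->
  (limf_esup (fun x => p lam x / (f x)%:E) at_infinity < +oo)%E.
Proof.
move=> fh lam0; have [C C0 pC] :=
  poisson_bound d0 theta1 mf f0 fgt0 K1 f_decr intf f_shift fh lam0.
apply: (@le_lt_trans _ _ C%:E); last exact: ltry.
apply: (@le_trans _ _ (ereal_sup ((fun x => p lam x / (f x)%:E)%E @`
    [set x | 1 < enorm x]))).
  by apply: ereal_inf_lbound; exists [set x | 1 < enorm x] => //; exists 1.
apply: ge_ereal_sup => _ [x /= x1 <-].
have fx : 0 < f x by apply: fgt0; rewrite -enorm_gt0 (lt_trans ltr01).
rewrite inver gt_eqF// lee_pdivrMr//.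
by apply: pC; exact: ltW.
Qed.

(** Both parts of the integrand are integrable, so no infinite value is lost by [fine]; this matches
    the exponent in (b) with that of [poisson_coef]. *)
Lemma fine_tilted h : exp_moment theta gamma ef = h%:E ->
  fine (lebesgue_int (fun z => ((expR (gamma * dot theta z) - 1) * f z)%:E)) =
  h - m.
Proof.
move=> fh.
have mm := emeasurable_funM (lmeas_expdot theta gamma) mef.
have i1 : (@lebesgue_rV R d).-integrable setT
    (fun z => (expR (gamma * dot theta z))%:E * (f z)%:E)%E.
  apply/integrableP; split => //.
  under eq_integral => y _ do rewrite gee0_abs ?mule_ge0 ?lee_fin ?expR_ge0//.
  by rewrite [X in (X < _)%E]fh ltry.
have i2 : (@lebesgue_rV R d).-integrable setT ef.
  apply/integrableP; split => //.
  under eq_integral => y _ do rewrite gee0_abs//.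
  by rewrite [X in (X < _)%E]intf ltry.
have := integralB measurableT i1 i2.
rewrite [X in _ = (X - _)%E -> _]fh [X in _ = (_ - X)%E -> _]intf => E.
rewrite (_ : lebesgue_int _ = (h%:E - m%:E)%E)//.
rewrite -E; congr lebesgue_int; apply/funext => z /=.
by rewrite mulrBl mul1r EFinB EFinM.
Qed.

Lemma tail_poisson_limit h lam y : tail_class theta gamma f h -> 0 < lam ->
  (p lam (t *: theta - y)%R / (lam * f (t *: theta))%:E)%E @[t --> +oo] -->
  (expR (gamma * dot theta y + lam *
     fine (lebesgue_int (fun z => ((expR (gamma * dot theta z) - 1) * f z)%:E))))%:E.
Proof.
move=> fh lam0; rewrite (fine_tilted (tail_moment fh)).
have := cvgeZl (erefl : lam^-1%:E \is a fin_num)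
  (poisson_limit d0 theta1 mf f0 fgt0 K1 f_decr intf f_shift fh lam0 (y := y)).
rewrite -EFinM (_ : lam^-1 * _ = expR (gamma * dot theta y + lam * (h - m))).
  apply: cvg_trans; apply: near_eq_cvg; exists 0; split => // t t0.
  have ft := fray t0.
  by rewrite inver gt_eqF ?mulr_gt0// invfM EFinM muleCA.
rewrite expRD mulrBr expRD /poisson_coef; field; by rewrite gt_eqF.
Qed.

(* Fatou bounds the convolution square from below; from above, keep the terms
   [n = 1, 2] of the series and let [lam] be small. *)
Lemma poisson_limit_tail (lim : forall lam : R, 0 < lam ->
    (p lam (t *: theta)%R / (lam * f (t *: theta))%:E)%E @[t --> +oo] -->
    (expR (lam * fine (lebesgue_int (fun z =>
      ((expR (gamma * dot theta z) - 1) * f z)%:E))))%:E) :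
  (exp_moment theta gamma ef < +oo)%E -> exists h, tail_class theta gamma f h.
Proof.
move=> mom; set h := fine (exp_moment theta gamma ef).
have mom0 : (0 <= exp_moment theta gamma ef)%E.
  by apply: lint_ge0 => y; rewrite mule_ge0// lee_fin expR_ge0.
have fh : exp_moment theta gamma ef = h%:E by rewrite fineK// ge0_fin_numE.
have h0 : 0 <= h by exact: fine_ge0.
exists h; apply: Build_tail_class => //; apply/cvge_pinftyP => u uoo.
apply: cvge_between => e e0.
  have lower b := half_int_lower b mf mf f0 f0 (fun t => f0 (t *: theta)) ler01
    f_shift fh uoo (divr_gt0 e0 (ltr0n R 2)).
  apply: filterS2 (lower true) (lower false) => n l1 l2.
  have := conv_half theta1 (u n) 0 mf mf f0 f0; rewrite subr0 => ->.
  have -> : (fun y : V => f (y - 0)) = f by apply/funext => y; rewrite subr0.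
  rewrite ge0_muleDl ?half_int_ge0//.
  rewrite (_ : h + h - e = (1 * h - e / 2) + (1 * h - e / 2)); last by field.
  by rewrite EFinD leeD.
pose e4 := e / 4; have e40 : 0 < e4 by rewrite divr_gt0.
(* Chosen so that [lam * h * (h + e4) <= e4], which below yields [h * expR (lam * h) <= h + e4]. *)
pose lam := e4 / ((h + 1) * (h + e4)).
have den : 0 < (h + 1) * (h + e4) by rewrite mulr_gt0// ltr_wpDl.
have lam0 : 0 < lam by rewrite divr_gt0.
have lamden : lam * ((h + 1) * (h + e4)) = e4 by rewrite divfK// gt_eqF.
(* This tolerance is worth [e4] once the exponential prefactor and [lam] are divided out; with the
   error [e4] of the exponential, the final bound is [2 * (h + e4 + e4) = h + h + e]. *)
pose D := expR (- (lam * m)) * (lam * e4).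
have D0 : 0 < D.
  by apply: mulr_gt0; [exact: expR_gt0|exact: mulr_gt0].
have := cvge_eps (lim lam lam0) D0; rewrite (fine_tilted fh) => limD.
have limu : \forall n \near \oo,
    (p lam (u n *: theta)%R / (lam * f (u n *: theta))%:E <=
     (expR (lam * (h - m)) + D)%:E)%E.
  have [T [_ TP]] := limD; have /cvgryPge/(_ (T + 1)) := uoo.
  by apply: filterS => n un; apply: (TP (u n) _).2; lra.
have u0 : \forall n \near \oo, 0 < u n.
  by have /cvgryPge/(_ 1) := uoo; apply: filterS => n; apply: lt_le_trans.
apply: filterS2 limu u0 => n pn un0.
have fu := fray un0.
have lamf : 0 < lam * f (u n *: theta) by rewrite mulr_gt0.
move: pn; rewrite inver gt_eqF// lee_pdivrMr// => pn.
have := le_trans (poisson_ge12 f0 intf lam0 (u n *: theta)) pn.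
have cc : (0 <= conv ef ef (u n *: theta)%R)%E by exact: conv_ge0.
rewrite lee_pdivrMr//; move: cc.
case: (conv ef ef (u n *: theta)%R) => [s| |]//; last first.
  rewrite gt0_muley ?lte_fin ?divr_gt0 ?exprn_gt0// addey//.
  by rewrite gt0_muley ?lte_fin ?expR_gt0.
rewrite -!EFinM !lee_fin => s0 ub.
set F := f (u n *: theta) in fu lamf ub *.
set Em := expR (- (lam * m)) in ub *.
have Em0 : 0 < Em by exact: expR_gt0.
have EE : expR (lam * (h - m)) = Em * expR (lam * h).
  by rewrite -expRD; congr expR; ring.
have ub1 : lam * F + lam ^+ 2 / 2 * s <= (expR (lam * h) + lam * e4) * (lam * F).
  rewrite -(ler_pM2l Em0); apply: (le_trans ub); rewrite EE /D -/Em.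
  by rewrite le_eqVlt; apply/orP; left; apply/eqP; ring.
(* The term [n = 1] cancels the constant term of the exponential, so both sides are now of first
   order in [lam]. *)
have ub2 : lam / 2 * s <= (expR (lam * h) - 1 + lam * e4) * F.
  rewrite -(ler_pM2l lam0); rewrite -subr_ge0; move: ub1; rewrite -subr_ge0.
  by congr (_ <= _); field.
(* From [1 - x <= expR (- x)] at [x = lam * h]; it bounds [expR x - 1] by [x * expR x] and also
   controls [h * expR x]. *)
have ex : expR (lam * h) * (1 - lam * h) <= 1.
  rewrite -[leRHS](expRxMexpNx_1 (lam * h)) ler_pM2l ?expR_gt0//.
  exact: expR_ge1Dx.
have hex : h * expR (lam * h) <= h + e4.
  have lh : (h + e4) * (1 - lam * h) >= h.
    have : lam * h * (h + e4) <= e4.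
      rewrite -[leRHS]lamden -[leLHS]mulrA ler_pM2l// ler_wpM2r//.
      by rewrite addr_ge0// ltW.
      by rewrite lerDl.
    by move=> ?; rewrite mulrBr mulr1; lra.
  have E0 : 0 < expR (lam * h) by exact: expR_gt0.
  have he0 : 0 <= h + e4 by rewrite addr_ge0// ltW.
  apply: (@le_trans _ _ ((h + e4) * (1 - lam * h) * expR (lam * h))).
    by rewrite ler_wpM2r// ltW.
  rewrite -mulrA (mulrC (1 - _)); apply: ler_piMr => //.
have ub3 : expR (lam * h) - 1 <= lam * (h + e4).
  have : expR (lam * h) - 1 <= lam * (h * expR (lam * h)).
    by move: ex; rewrite mulrBr mulr1; lra.
  by move=> /le_trans; apply; rewrite ler_pM2l.
have ub4 : lam / 2 * s <= (lam * (h + e4) + lam * e4) * F.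
  by apply: (le_trans ub2); rewrite ler_pM2r// lerD2r.
rewrite -(ler_pM2l (divr_gt0 lam0 (ltr0n R 2))); apply: (le_trans ub4).
by rewrite le_eqVlt; apply/orP; left; apply/eqP; rewrite /e4; field.
Qed.

(* The squares of [f] along the ray are dominated by those of [p lam], whose
   integrals converge because [p lam] is in the class. *)
Lemma poisson_subexp_tail lam : 0 < lam -> subexp_class theta gamma (p lam) ->
  (limf_esup (fun x => p lam x / (f x)%:E) at_infinity < +oo)%E ->
  exists h, tail_class theta gamma f h.
Proof.
move=> lam0 [_ p0 _ pshift pmom pconv] plim.
have mp := lmeas_poisson mf f0 intf lam0.
have poo := lint_poisson mf f0 intf lam0.
set kappa := expR (- (lam * m)) * lam.
have kap0 : 0 < kappa by rewrite mulr_gt0 ?expR_gt0.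
have kapp x : ((kappa * f x)%:E <= p lam x)%E.
  exact: (poisson_ge1 f0 intf lam0).
have [C [T [C0 T0 pC]]] : exists C T : R, [/\ 0 < C, 0 < T &
    forall x, T < enorm x -> (p lam x <= (C * f x)%:E)%E].
  have [_ [A [T _ TA] <-] supA] := ereal_inf_lt plim.
  have [C [C0 supC]] : exists C : R, 0 < C /\
      (ereal_sup ((fun x => p lam x / (f x)%:E)%E @` A) <= C%:E)%E.
    move: supA; case: (ereal_sup _) => [s| |]// _; last by exists 1; rewrite leNye.
    by exists (Num.max s 1); rewrite lee_fin le_max lexx lt_max ltr01 orbT.
  exists C, (Num.max T 1); split; rewrite ?lt_max ?ltr01 ?orbT//.
  move=> x; rewrite gt_max => /andP[xT x1].
  have fx : 0 < f x by apply: fgt0; rewrite -enorm_gt0 (lt_trans ltr01).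
  have : (p lam x / (f x)%:E <= C%:E)%E.
    by apply: le_trans supC; apply: ereal_sup_ubound; exists x => //; exact: TA.
  by rewrite inver gt_eqF// lee_pdivrMr.
(* A real version of [p lam], equal to it wherever it is finite. Where it is infinite [fine] returns
   [0], and the maximum restores the lower bound by [kappa * f] at every point. *)
pose pr x := Num.max (fine (p lam x)) (kappa * f x).
have mpr : lmeas pr.
  exact: (measurable_maxr (lmeas_fine mp) (lmeasZ kappa mf)).
have pr0 x : 0 <= pr x by rewrite le_max fine_ge0.
have pr_kap x : kappa * f x <= pr x by rewrite le_max lexx orbT.
have prE x : p lam x \is a fin_num -> p lam x = (pr x)%:E.
  move=> px; rewrite /pr max_l ?fineK//.
  by rewrite -lee_fin fineK.
have pr_ae : lebesgue_ae_eq (p lam) (EFin \o pr).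
  apply: ae_lebesgueS (lint_fin_ae mp p0 poo) => y py.
  by apply: prE; rewrite py.
have prT x : T < enorm x -> p lam x = (pr x)%:E.
  move=> xT; apply: prE; rewrite ge0_fin_numE//.
  by apply: le_lt_trans (pC _ xT) _; exact: ltry.
have mepr : lmeas (EFin \o pr) by exact/measurable_EFinP/mpr.
have epr0 x : (0 <= (EFin \o pr) x)%E by rewrite lee_fin.
set k := fine (exp_moment theta gamma (p lam)).
have pk : exp_moment theta gamma (p lam) = k%:E.
  rewrite fineK// ge0_fin_numE//; apply: lint_ge0 => y.
  by rewrite mule_ge0// lee_fin expR_ge0.
have prray t : T < t -> p lam (t *: theta) = (pr (t *: theta))%:E /\
    0 < pr (t *: theta).
  move=> tT; have t0 : 0 < t by lra.
  split; first by apply: prT; rewrite enorm_ray// ltW.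
  by apply: lt_le_trans (pr_kap _); rewrite mulr_gt0// fray.
have prt : tail_class theta gamma pr k.
  apply: Build_tail_class => //.
  - exists T; split; first exact: num_real.
    by move=> t /prray[].
  - move=> y; have /fine_cvgP[_] := pshift y; rewrite mul1r.
    apply: cvg_trans; apply: near_eq_cvg.
    exists (T + enorm y); split=> [|t tT]; first exact: num_real.
    have y0 := enorm_ge0 y.
    have [|pt prt0] := prray t; first by lra.
    rewrite /= pt inver gt_eqF// prT//.
    have := enorm_sub_ge (t *: theta) y; rewrite enorm_ray; lra.
  - by rewrite -(exp_moment_ae theta gamma mp mepr p0 epr0 pr_ae).
  - have -> : (k + k)%:E = (2%:E * exp_moment theta gamma (p lam))%E.
      by rewrite pk -EFinM; congr EFin; ring.
    rewrite -(conv_ae mp mp mepr mepr p0 p0 epr0 epr0 pr_ae pr_ae).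
    move: pconv; apply: cvg_trans; apply: near_eq_cvg.
    exists T; split=> [|t tT]; first exact: num_real.
    have [pt prt0] := prray t tT.
    by rewrite /= pt inver gt_eqF.
set h := fine (exp_moment theta gamma ef).
have fh : exp_moment theta gamma ef = h%:E.
  have mom0 : (0 <= exp_moment theta gamma ef)%E.
    by apply: lint_ge0 => y; rewrite mule_ge0// lee_fin expR_ge0.
  rewrite fineK// ge0_fin_numE//.
  rewrite -(@lte_pmul2l _ kappa%:E) ?lte_fin//.
  apply: (@le_lt_trans _ _ (exp_moment theta gamma (p lam))); last first.
    by rewrite gt0_muley ?lte_fin// pk ltry.
  have mm := emeasurable_funM (lmeas_expdot theta gamma) mef.
  have mm0 y : (0 <= (expR (gamma * dot theta y))%:E * ef y)%E.
    by rewrite mule_ge0// lee_fin expR_ge0.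
  have kap0' : (0 <= kappa%:E)%E by rewrite lee_fin ltW.
  rewrite -(lintZl mm mm0 kap0'); apply: le_lint.
  - exact: measurable_funeM.
  - exact: (emeasurable_funM (lmeas_expdot theta gamma) mp).
  - by move=> y; rewrite mule_ge0.
  - move=> y; rewrite muleCA; apply: lee_wpmul2l; last exact: kapp.
    by rewrite lee_fin expR_ge0.
have C'0 : 0 <= C / (kappa * kappa).
  by apply: divr_ge0; [exact: ltW|apply: mulr_ge0; exact: ltW].
have m0' : lmeas (fun _ : V => 0 : R) by exact: (@measurable_cst _ _ _ _ _ (0 : R)).
(* The constant [C / (kappa * kappa)] comes from [f <= pr / kappa] in both factors and [pr <= C * f]
   in the normaliser; the domination holds for every [y], so [w] is zero. *)
have lim b : (half_int theta b t f f * (f (t *: theta))^-1%:E)%E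
    @[t --> +oo] --> (1 * h)%:E.
  have w0 : (lebesgue_int (EFin \o (fun _ : V => 0%R : R)) < +oo)%E.
    by rewrite /lebesgue_int integral0 ltry.
  apply: (half_int_dominated theta1 prt mf mf m0' f0 f0 (fun _ => lexx 0)
    (fun t => f0 (t *: theta)) ler01 f_shift fh w0 C'0).
  exists T; split=> [|t tT y _]; first exact: num_real.
  have [pt prt0] := prray t tT.
  have t0 : 0 < t by lra.
  have ft := fray t0.
  have prC : pr (t *: theta) <= C * f (t *: theta).
    by rewrite -lee_fin -pt; apply: pC; rewrite enorm_ray// ltW.
  rewrite addr0 ler_pdivrMr//.
  apply: (@le_trans _ _ ((pr (t *: theta - y) / kappa) * (pr y / kappa))).
    by apply: ler_pM => //; rewrite ler_pdivlMr// mulrC.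
  rewrite (_ : C / (kappa * kappa) * (pr (t *: theta - y) * pr y / pr (t *: theta))
    * f (t *: theta) = (pr (t *: theta - y) / kappa) * (pr y / kappa) *
    (C * f (t *: theta) / pr (t *: theta))); last by field; rewrite !gt_eqF.
  apply: ler_peMr; first by rewrite mulr_ge0// divr_ge0// ltW.
  by rewrite ler_pdivlMr// mul1r.
exists h; apply: Build_tail_class => //.
rewrite -[h in X in _ --> X]mul1r EFinD.
apply: (cvg_trans _
  (cvgeD (isT : (1 * h)%:E +? (1 * h)%:E)%E (lim true) (lim false))).
apply: near_eq_cvg; apply: nearW => t /=.
have := conv_half theta1 t 0 mf mf f0 f0; rewrite subr0 => ->.
have -> : (fun y : V => f (y - 0)) = f by apply/funext => y; rewrite subr0.
by apply/esym/ge0_muleDl; exact: half_int_ge0.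
Qed.

End characterisation.

Theorem theorem1p6 (R : realType) (d : nat) (hd : (1 <= d)%N)
    (f : 'rV[R]_d -> R) (hf : density f) (harf : almost_radial_decreasing f)
    (theta : 'rV[R]_d) (htheta : enorm theta = 1)
    (gamma : R) (hgamma : 0 <= gamma)
    (hshift : shift_limit theta gamma (EFin \o f)) :
  [<->
    (* (a) *)
    subexp_class theta gamma (EFin \o f);
    (* (b) *)
    (exp_moment theta gamma (EFin \o f) < +oo)%E /\
    forall lambda : R, 0 < lambda -> forall y : 'rV[R]_d,
      (poisson_density f lambda (t *: theta - y)%R
         / (lambda * f (t *: theta))%:E)%E @[t --> +oo%R]
      --> (expR (gamma * dot theta y + lambda *
             fine (lebesgue_int (fun z =>
               ((expR (gamma * dot theta z) - 1) * f z)%:E))))%:E;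
    (* (c) *)
    exists lambda : R, [/\ 0 < lambda,
      subexp_class theta gamma (poisson_density f lambda)
    & (limf_esup (fun x => poisson_density f lambda x / (f x)%:E)
         at_infinity < +oo)%E];
    (* (c') *)
    forall lambda : R, 0 < lambda ->
      subexp_class theta gamma (poisson_density f lambda) /\
      (limf_esup (fun x => poisson_density f lambda x / (f x)%:E)
         at_infinity < +oo)%E ].
Proof.
have [/integrableP[mef foo] f0 _] := hf.
have mf : lmeas f by exact/measurable_EFinP/mef.
have fgt0 x : x != 0 -> 0 < f x.
  case: harf => g [c [g0 _ c1 fg]] x0; apply: lt_le_trans (fg x x0).1.
  by rewrite mulr_gt0 ?invr_gt0 ?(lt_le_trans ltr01 c1)// g0// enorm_gt0.
have [K [K1 f_decr]] : exists K : R, 1 <= K /\ forall z w : 'rV[R]_d,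
    w != 0 -> enorm w <= enorm z -> f z <= K * f w.
  (* Through the radial profile: [f z <= c * g (enorm z) <= c * g (enorm w) <= c * c * f w]. *)
  case: harf => g [c [g0 g_decr c1 fg]]; exists (c * c); split.
    exact: mulr_ege1.
  move=> z w w0 wz; have ew : 0 < enorm w by rewrite enorm_gt0.
  have c0 : 0 < c by exact: lt_le_trans c1.
  have z0 : z != 0 by rewrite -enorm_gt0 (lt_le_trans ew).
  apply: (le_trans (fg z z0).2); rewrite -mulrA ler_pM2l//.
  apply: (le_trans (g_decr _ _ ew wz)).
  by rewrite -ler_pdivrMl//; exact: (fg w w0).1.
pose m := fine (lebesgue_int (EFin \o f)).
have intf : lebesgue_int (EFin \o f) = m%:E.
  rewrite fineK// ge0_fin_numE; last by apply: lint_ge0 => y; rewrite lee_fin.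
  apply: le_lt_trans foo; rewrite le_eqVlt; apply/orP; left; apply/eqP.
  by apply: eq_integral => y _; rewrite gee0_abs// lee_fin.
have ray0 t : 0 < t -> t *: theta != 0 :> 'rV[R]_d.
  move=> t0; rewrite -enorm_gt0 enormZ htheta mulr1.
  by rewrite ger0_norm// ltW.
have f_shift : ray_limit theta gamma f (fun t => f (t *: theta)) 1.
  move=> y; have /fine_cvgP[_] := hshift y; rewrite mul1r.
  apply: cvg_trans; apply: near_eq_cvg; exists 0; split => // t t0.
  by rewrite /= inver gt_eqF// fgt0// ray0.
have poisson_tail (h lam : R) : tail_class theta gamma f h -> 0 < lam ->
    subexp_class theta gamma (poisson_density f lam) /\
    (limf_esup (fun x => poisson_density f lam x / (f x)%:E) at_infinity
      < +oo)%E.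
  move=> fh lam0; split.
    exact: (poisson_subexp hd htheta mf f0 fgt0 K1 f_decr intf f_shift fh lam0).
  exact: (poisson_limsup hd htheta mf f0 fgt0 K1 f_decr intf f_shift fh lam0).
have tail_of_poisson (lam : R) := @poisson_subexp_tail _ _ f theta gamma m
  htheta mf f0 fgt0 intf f_shift lam.
tfae.
- move=> /(subexp_tail htheta mf f0 fgt0 f_shift)[h fh].
  split; first by rewrite (tail_moment fh) ltry.
  move=> lam lam0 y.
  exact: (tail_poisson_limit hd htheta mf f0 fgt0 K1 f_decr intf f_shift fh lam0).
- move=> [mom lim]; have [|h fh] := poisson_limit_tail htheta mf f0 fgt0 intf
    f_shift _ mom.
    move=> lam lam0; have := lim lam lam0 0; rewrite dot0r mulr0 add0r.
    apply: cvg_trans; apply: near_eq_cvg; apply: nearW => t.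
    by rewrite subr0.
  by exists 1; have [] := poisson_tail h 1 fh ltr01.
- move=> [lam [lam0 psub plim]] mu mu0.
  have [h fh] := tail_of_poisson lam lam0 psub plim.
  exact: poisson_tail fh mu0.
- move=> /(_ 1 ltr01)[psub plim].
  have [h fh] := tail_of_poisson 1 ltr01 psub plim.
  exact: (tail_subexp htheta mf f0 fgt0 intf f_shift fh).
Qed.
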